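(* Let $\ell$ be a log-posterior density on a $D$-dimensional parameter space $\Theta$, with MAP estimate $\hat\theta$ (so $\nabla\ell(\hat\theta)=0$). Equip $\Theta$ with the Riemannian metric with coefficient matrix $G(\theta)=I_D+\nabla\ell(\theta)\nabla\ell(\theta)^\top$, so that $G(\hat\theta)=I_D$. Let $\theta(t)$ be the geodesic with $\theta(0)=\hat\theta$ and initial velocity $v(0)$, and write $v(t)=\dot\theta(t)$. (i) The quantity $\|v(t)\|^2_{G(\theta(t))}=\|v(t)\|^2+\langle v(t),\nabla\ell(\theta(t))\rangle^2$ is constant in $t$. For every $t$ other than $0$ one has $\|v(t)\|<\|v(0)\|$, except in the rare cases when the gradient $\nabla\ell(\theta(t))$ is null or exactly orthogonal to $v(t)$. (ii) Since the exponential map integrates for unit time, the Euclidean distance from each sample $\mathrm{Exp}_{\hat\theta}(v(0))$ of the Riemannian Laplace approximation with this metric to $\hat\theta$ is upper-bounded by, and almost always smaller than, the corresponding distance for the Euclidean Laplace approximation, which is $\|v(0)\|$. (iii) The Riemannian Laplace approximation with this metric is not exact even for Gaussian targets, and hence not for infinite-data posteriors. Instead it underestimates the uncertainty.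
   Context: $\nabla\ell$ is the Euclidean gradient, and $\|\cdot\|$ and $\langle\cdot,\cdot\rangle$ are the Euclidean norm and inner product; $\|v\|_{G}^2=v^\top Gv$. $\mathrm{Exp}_{\hat\theta}(v(0))=\theta(1)$ is the Riemannian exponential map (Levi-Civita connection). The Riemannian Laplace approximation with this metric is the distribution of $\mathrm{Exp}_{\hat\theta}(v)$ for $v\sim\mathcal{N}(0,\Sigma)$ with $\Sigma=(-\nabla^2\ell(\hat\theta))^{-1}$. The Euclidean Laplace approximation uses the same $v$ with the Euclidean metric $G=I_D$, giving samples $\hat\theta+v$, i.e. the distribution $\mathcal{N}(\hat\theta,\Sigma)$. ''Exact'' means that the distribution of the samples is the target. ''Infinite-data posteriors'' refers to posteriors in the limit of infinite data, which, under regularity conditions, become Gaussian by the Bernstein–von Mises theorem. *)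

(* Defs.v *)
From HB Require Import structures.
From mathcomp Require Import all_boot all_order all_algebra.
From mathcomp Require Import all_classical all_reals all_analysis.
Import Order.TTheory GRing.Theory Num.Theory.
Import numFieldNormedType.Exports.

Set Implicit Arguments.
Unset Strict Implicit.
Unset Printing Implicit Defensive.

Local Open Scope ring_scope.
Local Open Scope classical_set_scope.

Definition rV_display : measure_display -> measure_display.
Proof. exact. Qed.

Section measurable_rV.
Context (R : realType) (n : nat).

Let coor (i : 'I_n) (x : 'rV[R]_n) : R := x 0 i.

Let rV_set0 : g_sigma_preimage coor set0.
Proof. exact: sigma_algebra0. Qed.

Let rV_setC A : g_sigma_preimage coor A -> g_sigma_preimage coor (~` A).
Proof. exact: sigma_algebraC. Qed.

Let rV_bigcup (F : _^nat) : (forall i, g_sigma_preimage coor (F i)) ->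
  g_sigma_preimage coor (\bigcup_i (F i)).
Proof. exact: sigma_algebra_bigcup. Qed.

(* The product sigma-algebra, i.e. the Borel sets of R^n *)
HB.instance Definition _ := @isMeasurable.Build (rV_display default_measure_display)
  'rV[R]_n (g_sigma_preimage coor) rV_set0 rV_setC rV_bigcup.

End measurable_rV.

Section measurable_rV_lemmas.
Context (R : realType).

Lemma measurable_coor n (i : 'I_n) :
  measurable_fun [set: 'rV[R]_n] (fun x : 'rV[R]_n => x 0 i).
Proof.
move=> _ Y mY; rewrite setTI; apply: sub_sigma_algebra => /=.
rewrite -bigcup_seq/=; exists i => /=; first by rewrite mem_index_enum.
by exists Y => //; rewrite setTI.
Qed.

Lemma measurable_fun_rVP d (T : measurableType d) n (f : T -> 'rV[R]_n) :
  (forall i, measurable_fun [set: T] (fun x => f x 0 i)) ->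
  measurable_fun [set: T] f.
Proof.
move=> mf _ Y mY; rewrite setTI.
pose G : set (set 'rV[R]_n) := [set A | measurable (f @^-1` A)].
suff: @measurable _ 'rV[R]_n `<=` G by apply.
apply: smallest_sub.
  split => /=.
  - by rewrite /G /= preimage_set0.
  - move=> A GA; rewrite /G /= setTD preimage_setC; exact: measurableC.
  - move=> F GF; rewrite /G /= preimage_bigcup.
    by apply: bigcupT_measurable => k; exact: GF.
move=> A; rewrite -bigcup_seq/= => -[i _] [B mB <-].
by rewrite /G /= setTI -[X in measurable X]setTI; exact: mf.
Qed.

Definition consrV n (p : R * 'rV[R]_n) : 'rV[R]_n.+1 := row_mx (p.1)%:M p.2.

Definition unconsrV n (x : 'rV[R]_n.+1) : R * 'rV[R]_n :=
  (x 0 0, \row_i x 0 (lift 0 i)).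

Lemma consrVK n : cancel (@consrV n) (@unconsrV n).
Proof.
case=> a x; rewrite /unconsrV /consrV /=; congr (_, _).
  have -> : (0 : 'I_n.+1) = lshift n (0 : 'I_1) by apply: val_inj.
  by rewrite (row_mxEl (a%:M : 'M[R]_1)) mxE eqxx mulr1n.
apply/rowP => i; rewrite mxE.
have -> : lift 0 i = rshift 1 i by apply: val_inj.
by rewrite (row_mxEr (a%:M : 'M[R]_1)).
Qed.

Lemma measurable_consrV n : measurable_fun [set: R * 'rV[R]_n] (@consrV n).
Proof.
apply: measurable_fun_rVP => i; rewrite /consrV.
case: (unliftP 0 i) => [j|] ->.
  have -> : lift 0 j = rshift 1 j by apply: val_inj.
  rewrite (_ : (fun _ => _) = (fun x : 'rV[R]_n => x 0 j) \o snd); last first.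
    by apply/funext => p; rewrite /= (row_mxEr ((p.1)%:M : 'M[R]_1)).
  by apply: measurableT_comp; [exact: measurable_coor|exact: measurable_snd].
have -> : (0 : 'I_n.+1) = lshift n (0 : 'I_1) by apply: val_inj.
rewrite (_ : (fun _ => _) = fst); first exact: measurable_fst.
by apply/funext => p; rewrite /= (row_mxEl ((p.1)%:M : 'M[R]_1)) mxE eqxx mulr1n.
Qed.

Lemma measurable_unconsrV n :
  measurable_fun [set: 'rV[R]_n.+1] (@unconsrV n).
Proof.
apply/measurable_fun_pairP; split; first exact: measurable_coor.
apply: measurable_fun_rVP => i.
by under eq_fun do rewrite mxE; exact: measurable_coor.
Qed.

End measurable_rV_lemmas.

Section leb_step.
Context (R : realType) (n : nat).
Variable mu : {sigma_finite_measure set 'rV[R]_n -> \bar R}.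

Definition leb_step : set 'rV[R]_n.+1 -> \bar R :=
  pushforward (lebesgue_measure \x mu)%E (@consrV R n).

Let leb_step0 : leb_step set0 = 0%E.
Proof. by rewrite /leb_step /pushforward preimage_set0 measure0. Qed.

Let leb_step_ge0 A : (0 <= leb_step A)%E.
Proof. by rewrite /leb_step /pushforward measure_ge0. Qed.

Let leb_step_sigma_additive : semi_sigma_additive leb_step.
Proof.
move=> F mF tF mUF; rewrite /leb_step /pushforward preimage_bigcup.
apply: measure_semi_sigma_additive.
- by move=> k; rewrite -[X in measurable X]setTI; exact: measurable_consrV.
- apply/trivIsetP => /= i j _ _ ij; rewrite -preimage_setI.
  by move/trivIsetP : tF => /(_ _ _ _ _ ij) ->//; rewrite preimage_set0.
- rewrite -preimage_bigcup -[X in measurable X]setTI.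
  exact: measurable_consrV.
Qed.

HB.instance Definition _ := isMeasure.Build _ _ _ leb_step
  leb_step0 leb_step_ge0 leb_step_sigma_additive.

Let sigma_finite_leb_step : sigma_finite setT leb_step.
Proof.
have /sigma_finiteP[F [FT ndF Ff]] := sigma_finiteT (@lebesgue_measure R).
have /sigma_finiteP[G [GT ndG Gf]] := sigma_finiteT mu.
exists (fun k => @unconsrV R n @^-1` (F k `*` G k)).
  rewrite -preimage_bigcup -[LHS](preimage_setT (@unconsrV R n)).
  congr (_ @^-1` _); rewrite -setXTT FT GT predeqE => -[x y]; split.
    move=> [/= [p _ Fpx] [k _ Gky]]; exists (maxn p k) => //; split.
    - by move: x Fpx; exact/subsetPset/ndF/leq_maxl.
    - by move: y Gky; exact/subsetPset/ndG/leq_maxr.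
  by move=> [k _ []/= ? ?]; split; exists k.
move=> k; have [mF Fk] := Ff k; have [mG Gk] := Gf k; split.
  rewrite -[X in measurable X]setTI; apply: measurable_unconsrV => //.
  exact: measurableX.
rewrite /leb_step /pushforward -comp_preimage.
rewrite (_ : @unconsrV R n \o @consrV R n = id); last first.
  by apply/funext => p /=; rewrite consrVK.
by rewrite preimage_id product_measure1E// lte_mul_pinfty// ge0_fin_numE.
Qed.

HB.instance Definition _ := Measure_isSigmaFinite.Build _ _ _ leb_step sigma_finite_leb_step.

End leb_step.

(* Lebesgue measure on R^n, as an iterated product of one-dimensional ones *)
Fixpoint leb (R : realType) (n : nat) :
    {sigma_finite_measure set 'rV[R]_n -> \bar R} :=
  match n with
  | 0 => \d_(0 : 'rV[R]_0)
  | k.+1 => leb_step (leb R k)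
  end.

Section calculus.
Context (R : realType) (n : nat).
Implicit Types (u v x : 'rV[R]_n) (f : 'rV[R]_n -> R).

Definition dotp u v : R := \sum_i u 0 i * v 0 i.

(* The norm [`|x|] of the library on matrices is the sup norm *)
Definition enorm u : R := Num.sqrt (dotp u u).

Definition qform (A : 'M[R]_n) u : R := (u *m A *m u^T) 0 0.

Definition posdef (A : 'M[R]_n) : Prop :=
  A^T = A /\ forall u, u != 0 -> 0 < qform A u.

Definition basis (i : 'I_n) : 'rV[R]_n := delta_mx 0 i.

Fixpoint Ck (k : nat) f : Prop :=
  match k with
  | 0 => continuous f
  | k'.+1 => forall i, (forall x, derivable f x (basis i)) /\ Ck k' ('D_(basis i) f)
  end.

Definition grad f x : 'rV[R]_n := \row_i 'D_(basis i) f x.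

Definition hess f x : 'M[R]_n :=
  \matrix_(i, j) 'D_(basis i) ('D_(basis j) f) x.

End calculus.
Arguments basis {R n} i.

Section riemannian.
Context (R : realType) (n : nat).
Variable G : 'rV[R]_n -> 'M[R]_n.

Definition dmetric (l i j : 'I_n) (x : 'rV[R]_n) : R :=
  'D_(basis l) (fun y => G y i j) x.

(* Gamma^k_ij of the Levi-Civita connection; [dmetric l i j] is d_l G_ij *)
Definition christoffel (k i j : 'I_n) (x : 'rV[R]_n) : R :=
  2^-1 * \sum_l invmx (G x) k l *
    (dmetric i j l x + dmetric j i l x - dmetric l i j x).

(* [J] is the open time interval on which the geodesic is defined *)
Definition geodesic (J : set R) (theta : R -> 'rV[R]_n) : Prop :=
  [/\ open J, is_interval J & forall t, J t ->
    let v := theta^`() in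
    [/\ derivable theta t 1, derivable v t 1 &
      forall k, derive1 v t 0 k +
        \sum_i \sum_j christoffel k i j (theta t) * v t 0 i * v t 0 j = 0]].

(* The default value [x] is used only when no geodesic with initial velocity
   [v] reaches time 1; this does not happen for a complete metric *)
Definition Exp (x v : 'rV[R]_n) : 'rV[R]_n :=
  xget x [set p | exists (J : set R) (theta : R -> 'rV[R]_n),
    [/\ geodesic J theta, J 0 /\ J 1, theta 0 = x,
        theta^`() 0 = v & theta 1 = p]].

End riemannian.

Section laplace.
Context (R : realType) (n : nat).
Implicit Types (ell : 'rV[R]_n -> R) (th : 'rV[R]_n).

(* A log-density is given up to an additive normalising constant *)
Definition is_log_density (pi : probability 'rV[R]_n R) ell : Prop :=
  exists c : R, forall A, measurable A ->
    pi A = (\int[leb R n]_(x in A) (expR (ell x + c))%:E)%E.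

Definition gaussian (N : probability 'rV[R]_n R) (m : 'rV[R]_n) (S : 'M[R]_n) :=
  posdef S /\ is_log_density N (fun x => - (2^-1 * qform (invmx S) (x - m))).

(* [ell] is a log-density of [pi] with MAP estimate [th]; C^3 makes the
   metric C^2, so that geodesics are unique and depend continuously on the
   initial velocity *)
Definition log_posterior (pi : probability 'rV[R]_n R) ell th : Prop :=
  [/\ Ck 3 ell, is_log_density pi ell & forall x, ell x <= ell th].

Definition laplace_cov ell th : 'M[R]_n := invmx (- hess ell th).

Definition grad_metric ell (x : 'rV[R]_n) : 'M[R]_n :=
  1%:M + (grad ell x)^T *m grad ell x.

Definition euclidean_metric (x : 'rV[R]_n) : 'M[R]_n := 1%:M.

(* Distribution of Exp_th(v) for v of law [N]: the expectation of the indicator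
   of [Exp_th(v) \in A], i.e. [pushforward N (Exp G th) A], stated so that it
   needs no measurability proof for [Exp G th] *)
Definition laplace_law (G : 'rV[R]_n -> 'M[R]_n) th
    (N : probability 'rV[R]_n R) (A : set 'rV[R]_n) : \bar R :=
  (\int[N]_v (\1_A (Exp G th v))%:E)%E.

Definition exact (law pi : set 'rV[R]_n -> \bar R) : Prop :=
  forall A, measurable A -> law A = pi A.

Definition tv_dist (mu nu : set 'rV[R]_n -> \bar R) : \bar R :=
  ereal_sup [set `|mu A - nu A|%E | A in measurable].

End laplace.
Arguments euclidean_metric {R n} x.

(* Main.v *)
Require Import Defs.
From HB Require Import structures.
From mathcomp Require Import all_boot all_order all_algebra.
From mathcomp Require Import all_classical all_reals all_analysis.
From mathcomp Require Import measurable_realfun.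
From mathcomp Require Import ring lra.
Import Order.TTheory GRing.Theory Num.Theory.
Import numFieldNormedType.Exports.

Set Implicit Arguments.
Unset Strict Implicit.
Unset Printing Implicit Defensive.

Local Open Scope ring_scope.
Local Open Scope classical_set_scope.

(** Write [v = theta'] along a geodesic of the metric [I + grad ell grad ell^T].
    The curve [t |-> (theta t, ell (theta t))] lies on the graph of [ell] and has
    constant Euclidean speed [|v 0|], so its chords are no longer than its arcs:
    [|theta 1 - th|^2 + (ell (theta 1) - ell th)^2 <= |v 0|^2].  This gives (i) and
    (ii); equality would make [ell] constant along [theta], hence [v 0] isotropic
    for the Hessian at [th].

    For (iii), every sample landing where [ell th - ell x >= 1] has lost at least
    1 in squared length.  Comparing the measures of the shells
    [j < |x - th|^2 <= j + 1] one after the other bounds the mass of that set by the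
    total variation distances.  But if the posterior is close to its Laplace
    Gaussian, its maximal density is at least comparable to that of the Gaussian, so
    the set has mass bounded below by a constant depending only on the dimension.
    Bounded covariances make finitely many shells suffice.

    Neither existence nor uniqueness of geodesics is needed: without a geodesic
    reaching time 1, [Exp] returns [th] and the bound is trivial.  The laws are
    integrals of possibly nonmeasurable indicators; only their monotonicity is
    used. *)

(* The topology library shadows this name. *)
Local Notation basis := Defs.basis.

(** * Calculus *)

Section differentiation.
Context {R : realType} {n : nat}.
Implicit Types (f : 'rV[R]_n -> R) (x y e h : 'rV[R]_n).

Lemma is_derive_line f y e s : derivable f (s *: e + y) e ->
  is_derive s 1 (fun s : R => f (s *: e + y)) ('D_e f (s *: e + y)).
Proof.
move=> df.
have E : (fun h : R => h^-1 *: (f ((h *: 1 + s) *: e + y) - f (s *: e + y))) =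
    (fun h : R => h^-1 *: (f (h *: e + (s *: e + y)) - f (s *: e + y))).
  apply/funext => t; have -> : t *: (1 : R) = t by exact: mulr1.
  by rewrite scalerDl addrA.
split; first by rewrite /derivable /= E.
by rewrite /derive /= E.
Qed.

(** Steps of both signs are covered; the bound on [c] is what keeps the intermediate points of
    [C1_increment] inside the ball of radius [d]. *)
Lemma line_MVT f y e s : (forall x, derivable f x e) ->
  exists2 c, `|c| <= `|s| & f (s *: e + y) - f y = s * 'D_e f (c *: e + y).
Proof.
move=> df; have dg t := is_derive_line (df (t *: e + y)).
have cg : continuous (fun s : R => f (s *: e + y)).
  by move=> t; apply/differentiable_continuous/derivable1_diffP; case: (dg t).
have [s0|s0] := leP 0 s.
  have [c] := @MVT_segment _ _ _ 0 s s0 (fun t _ => dg t) (continuous_subspaceT cg).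
  rewrite in_itv/= => /andP[c0 cs].
  rewrite scale0r add0r subr0 mulrC => E; exists c => //.
  by rewrite !ger0_norm.
have [c] := @MVT_segment _ _ _ s 0 (ltW s0) (fun t _ => dg t) (continuous_subspaceT cg).
rewrite in_itv/= => /andP[cs c0].
rewrite scale0r add0r sub0r => E; exists c.
  by rewrite !ler0_norm ?lerN2 // ltW.
by rewrite -opprB E mulrN opprK mulrC.
Qed.

(** For [k] from 0 to [n] these points form a path from 0 to [h] that changes one coordinate at a
    time. *)
Definition row_prefix h (k : nat) : 'rV[R]_n :=
  \row_i (if (i < k)%N then h 0 i else 0).

Lemma row_prefixS h (k : 'I_n) :
  row_prefix h k.+1 = h 0 k *: basis k + row_prefix h k.
Proof.
apply/rowP => i; rewrite !mxE /= ltnS leq_eqVlt.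
rewrite val_eqE; have [->|ik] := eqVneq i k; first by rewrite ltnn mulr1 addr0.
by rewrite mulr0 add0r.
Qed.

Lemma coord_le_norm x (i : 'I_n) : `|x 0 i| <= `|x|.
Proof.
rewrite [leRHS]/Num.Def.normr/= mx_normrE.
exact: (le_bigmax _ (fun i : 'I_1 * 'I_n => `|x i.1 i.2|) (0, i)).
Qed.

Lemma norm_le_coord x (e : R) : 0 <= e -> (forall i, `|x 0 i| <= e) -> `|x| <= e.
Proof.
move=> e0 H; rewrite [leLHS]/Num.Def.normr/= mx_normrE.
by rewrite (bigmax_le _ e0)//= => -[i j] _; rewrite (ord1 i) H.
Qed.

Lemma grad_linear x f : linear (fun h => dotp h (grad f x)).
Proof.
move=> a u v; rewrite /dotp /= scaler_sumr -big_split; apply: eq_bigr => i _.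
by rewrite !mxE mulrDl /GRing.scale /= mulrA.
Qed.

Lemma dotp_continuous x : continuous (fun h => dotp h x).
Proof.
apply: continuous_big => [|i _ h]; first exact: add_continuous.
by apply: continuousM; [exact: coord_continuous|exact: cst_continuous].
Qed.

Lemma cvg_translate0 f x : {for x, continuous f} ->
  f (y + x) @[y --> (0 : 'rV[R]_n)] --> f x.
Proof.
move=> cf.
have T : {for 0, continuous (fun y : 'rV[R]_n => y + x)}.
  by apply: (@continuousD _ _ _ id (fun=> x) 0) => //; exact: cst_continuous.
have cf' : {for (fun y : 'rV[R]_n => y + x) 0, continuous f} by rewrite /= add0r.
by have := continuous_comp T cf'; rewrite /prop_for /continuous_at /= add0r.
Qed.

(** The increment telescopes along the row prefixes. Each piece is a one-variable mean value, and
    continuity of the partial derivatives at [x] lets them be evaluated at [x]. *)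
Lemma C1_increment f x : (forall i y, derivable f y (basis i)) ->
  (forall i, {for x, continuous ('D_(basis i) f)}) ->
  forall eps, 0 < eps -> \forall h \near (0 : 'rV[R]_n),
    `|f (h + x) - f x - dotp h (grad f x)| <= eps * `|h|.
Proof.
move=> df cf eps eps0.
(* Each of the [n] coordinates costs at most [eps' * |h|]; dividing by [n.+1] also covers
   [n = 0]. *)
pose eps' := eps / n.+1%:R.
have eps'0 : 0 < eps' by rewrite divr_gt0.
have : \forall y \near (0 : 'rV[R]_n), forall i,
    `|'D_(basis i) f (y + x) - 'D_(basis i) f x| <= eps'.
  apply: (@filter_forall _ _ _ _ (nbhs_filter (0 : 'rV[R]_n))) => i.
  have C : 'D_(basis i) f (y + x) @[y --> (0 : 'rV[R]_n)] --> 'D_(basis i) f x.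
    exact: (cvg_translate0 (cf i)).
  move/cvgrPdist_le : C => /(_ _ eps'0); apply: filterS => y.
  by rewrite distrC.
move/nbhs_norm0P => [d /= d0 H].
apply/nbhs_norm0P; exists d => //= h /= hd.
have Ef : f (h + x) - f x =
    \sum_(k < n) (f (row_prefix h k.+1 + x) - f (row_prefix h k + x)).
  rewrite -(big_mkord xpredT (fun k => f (row_prefix h k.+1 + x) - f (row_prefix h k + x))).
  rewrite telescope_sumr //; congr (f (_ + _) - f _).
    by apply/rowP => i; rewrite mxE ltn_ord.
  by rewrite [X in X + _](_ : _ = 0) ?add0r //; apply/rowP => i; rewrite !mxE.
rewrite Ef /dotp -sumrB.
apply: (@le_trans _ _ (\sum_(k < n) eps' * `|h|)); last first.
  rewrite sumr_const card_ord -mulrnAl ler_wpM2r // /eps' -[X in X <= _]mulr_natr.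
  by rewrite -mulrA ler_piMr ?(ltW eps0) // mulrC ler_pdivrMr // mul1r ler_nat.
apply: (le_trans (ler_norm_sum _ _ _)); apply: ler_sum => k _.
rewrite row_prefixS -(addrA (_ *: _)).
have [c cs ->] := line_MVT (row_prefix h k + x) (h 0 k) (fun x => df k x).
rewrite mxE -mulrBr normrM mulrC ler_pM //; last exact: coord_le_norm.
rewrite addrA; apply: H => /=; apply: le_lt_trans hd.
apply: norm_le_coord => // i; rewrite !mxE /=.
have [->|ik] := eqVneq i k; first by rewrite ltnn mulr1 addr0 (le_trans cs) ?coord_le_norm.
rewrite mulr0 add0r; case: ifP => _; first exact: coord_le_norm.
by rewrite normr0.
Qed.

Lemma C1_differentiable f x : (forall i y, derivable f y (basis i)) ->
  (forall i, {for x, continuous ('D_(basis i) f)}) ->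
  is_diff x f (fun h => dotp h (grad f x)).
Proof.
move=> df cf.
pose Lm := GRing.isLinear.Build _ _ _ _ _ (@grad_linear x f).
pose L : {linear 'rV[R]_n -> R} := HB.pack (fun h => dotp h (grad f x)) Lm.
have Ho : f \o shift x = cst (f x) + L +o_ (0 : 'rV[R]_n) id.
  apply/eqaddoP => eps eps0; have := C1_increment df cf eps0.
  by apply: filterS => h /=; rewrite opprD addrA.
have cL : continuous L by exact: dotp_continuous.
have E : 'd f x = L :> (_ -> _) by exact: diff_unique.
by split => //; apply/diff_locallyP; rewrite E.
Qed.

End differentiation.

(** * Euclidean inner product and positive definite matrices *)

Section dot_product.
Context {R : realType} {n : nat}.
Implicit Types (u v w : 'rV[R]_n) (A : 'M[R]_n).

Lemma dotpC u v : dotp u v = dotp v u.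
Proof. by apply: eq_bigr => i _; rewrite mulrC. Qed.

Lemma dotpDl u v w : dotp (u + v) w = dotp u w + dotp v w.
Proof. by rewrite -big_split; apply: eq_bigr => i _; rewrite mxE mulrDl. Qed.

Lemma dotpZl a u v : dotp (a *: u) v = a * dotp u v.
Proof. by rewrite /dotp mulr_sumr; apply: eq_bigr => i _; rewrite mxE mulrA. Qed.

Lemma dotpDr u v w : dotp w (u + v) = dotp w u + dotp w v.
Proof. by rewrite dotpC dotpDl !(dotpC w). Qed.

Lemma dotpZr a u v : dotp v (a *: u) = a * dotp v u.
Proof. by rewrite dotpC dotpZl dotpC. Qed.

Lemma dotpNl u v : dotp (- u) v = - dotp u v.
Proof. by rewrite -scaleN1r dotpZl mulN1r. Qed.

Lemma dotpNr u v : dotp v (- u) = - dotp v u.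
Proof. by rewrite dotpC dotpNl dotpC. Qed.

Lemma dotp0l v : dotp 0 v = 0.
Proof. by rewrite -(scale0r v) dotpZl mul0r. Qed.

Lemma dotp0r v : dotp v 0 = 0.
Proof. by rewrite dotpC dotp0l. Qed.

Lemma dotp_ge0 v : 0 <= dotp v v.
Proof. by apply: sumr_ge0 => i _; rewrite -expr2 sqr_ge0. Qed.

Lemma dotp_eq0 v : (dotp v v == 0) = (v == 0).
Proof.
apply/idP/eqP => [|->]; last by rewrite dotp0l.
rewrite psumr_eq0; last by move=> i _; rewrite -expr2 sqr_ge0.
move/allP => H; apply/rowP => i; rewrite mxE.
by have := H i; rewrite mem_index_enum -expr2 sqrf_eq0 => /(_ isT)/eqP.
Qed.

Lemma dotp_gt0 v : (0 < dotp v v) = (v != 0).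
Proof. by rewrite lt_def dotp_ge0 andbT dotp_eq0. Qed.

Lemma enorm_ge0 v : 0 <= enorm v.
Proof. exact: sqrtr_ge0. Qed.

Lemma enorm_sqr v : enorm v ^+ 2 = dotp v v.
Proof. by rewrite sqr_sqrtr // dotp_ge0. Qed.

Lemma enorm_le u v : (enorm u <= enorm v) = (dotp u u <= dotp v v).
Proof. by rewrite ler_sqrt // dotp_ge0. Qed.

Lemma enorm_lt u v : (enorm u < enorm v) = (dotp u u < dotp v v).
Proof. by rewrite !ltNge enorm_le. Qed.

Lemma qformE A u : qform A u = \sum_i \sum_j A i j * u 0 i * u 0 j.
Proof.
rewrite /qform mxE exchange_big /=; apply: eq_bigr => j _.
rewrite mxE mulr_suml; apply: eq_bigr => i _.
by rewrite !mxE (mulrC (A i j)).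
Qed.

Lemma mulmx_dotp u v : (u *m v^T) 0 0 = dotp u v.
Proof. by rewrite mxE; apply: eq_bigr => i _; rewrite mxE. Qed.

Lemma qform0 A : qform A 0 = 0.
Proof. by rewrite /qform !mul0mx mxE. Qed.

(** A row vector in the left kernel of [A] makes the form vanish. *)
Lemma qform_neq0_unitmx A : (forall u, u != 0 -> qform A u != 0) -> A \in unitmx.
Proof.
move=> HA; rewrite -row_free_unit -kermx_eq0; apply/rowV0P => u /sub_kermxP uA.
apply/eqP; apply: contraT => /HA; by rewrite /qform uA mul0mx mxE eqxx.
Qed.

Lemma posdef_unitmx A : posdef A -> A \in unitmx.
Proof. by move=> [_ HA]; apply: qform_neq0_unitmx => u /HA /gt_eqF ->. Qed.

Lemma qform_invmx A u : A^T = A -> A \in unitmx ->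
  qform (invmx A) u = qform A (u *m invmx A).
Proof.
move=> sA uA; rewrite /qform mulmxKV // trmx_mul.
by rewrite trmx_inv sA mulmxA.
Qed.

Lemma posdef_invmx A : posdef A -> posdef (invmx A).
Proof.
move=> pA; have uA := posdef_unitmx pA; case: pA => sA HA; split.
  by rewrite trmx_inv sA.
move=> u u0; rewrite qform_invmx //; apply: HA; apply: contra_neq u0 => uA0.
by rewrite -(mulmxKV uA u) uA0 mul0mx.
Qed.

(* [invmx] is the identity on singular matrices *)
Lemma posdef_of_invmx A : posdef (invmx A) -> posdef A.
Proof. by move/posdef_invmx; rewrite invmxK. Qed.

End dot_product.

(** * Derivatives along curves *)

Section curves.
Context {R : realType} {n : nat}.
Implicit Types (f : 'rV[R]_n -> R) (c : R -> 'rV[R]_n).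

Lemma Ck1_diff f x : Ck 1 f -> is_diff x f (fun h => dotp h (grad f x)).
Proof.
move=> H; apply: C1_differentiable; first by move=> i; case: (H i).
by move=> i; case: (H i) => _; exact.
Qed.

Lemma CkS k f : Ck k.+1 f -> Ck k f.
Proof.
elim: k f => [|k IH] f Hf /=.
  by move=> x; apply: differentiable_continuous; case: (Ck1_diff x Hf).
by move=> i; have [df Hi] := Hf i; split => //; exact: IH.
Qed.

Lemma is_derive_coord c t i : derivable c t 1 ->
  is_derive t 1 (fun s => c s 0 i) (derive1 c t 0 i).
Proof.
move=> dc; split; first by move/derivable_mxP : (dc); exact.
by rewrite derive1E (derive_mx dc) mxE.
Qed.

Lemma is_derive_chain f c t : Ck 1 f -> derivable c t 1 ->
  is_derive t 1 (fun s => f (c s)) (dotp (derive1 c t) (grad f (c t))).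
Proof.
move=> Hf dc; have /derivable1_diffP dc' := dc.
have [df Ef] := Ck1_diff (c t) Hf.
have dfc := differentiable_comp dc' df.
split; first exact/derivable1_diffP.
by rewrite (deriveE _ dfc) (diff_comp dc' df) /= Ef derive1E'.
Qed.

(** Derivatives are coordinatewise because [c2] will be the gradient along a geodesic, whose
    components are differentiated one by one with the chain rule. *)
Lemma is_derive_dotp c1 c2 (t : R) (d1 d2 : 'rV[R]_n) :
  (forall i, is_derive t 1 (fun s => c1 s 0 i) (d1 0 i)) ->
  (forall i, is_derive t 1 (fun s => c2 s 0 i) (d2 0 i)) ->
  is_derive t 1 (fun s => dotp (c1 s) (c2 s)) (dotp d1 (c2 t) + dotp (c1 t) d2).
Proof.
move=> H1 H2; rewrite /dotp.
have -> : (fun s : R => \sum_i c1 s 0 i * c2 s 0 i) =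
    \sum_(i < n) ((fun s => c1 s 0 i) * (fun s => c2 s 0 i)).
  by apply/funext => s; rewrite fct_sumE.
apply: is_derive_eq; rewrite -big_split; apply: eq_bigr => i _ /=.
by rewrite addrC /GRing.scale /=; congr (_ + _); rewrite mulrC.
Qed.

Lemma derive0_cst (J : set R) (f : R -> R) : is_interval J ->
  (forall t, J t -> is_derive t 1 f 0) -> forall a b, J a -> J b -> f a = f b.
Proof.
move=> iJ df.
suff H a b : a <= b -> J a -> J b -> f b = f a.
  move=> a b Ja Jb; have [/H ->//|/ltW/H ->//] := leP a b.
move=> ab Ja Jb.
have Jab t : t \in `[a, b]%R -> J t by rewrite in_itv/=; exact: iJ.
have cf : {within `[a, b], continuous f}.
  apply: derivable_within_continuous => t /Jab /df[]//.
have [c _] := @MVT_segment _ f (fun=> 0) a b ab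
  (fun t tab => df t (Jab t (subset_itv_oo_cc tab))) cf.
by rewrite mul0r => /eqP; rewrite subr_eq0 => /eqP.
Qed.

(** The difference quotient vanishes for small positive [h]. Being one-sided, the lemma applies at
    the left end of a time interval. *)
Lemma is_derive_right_cst (f : R -> R) (t d delta : R) : is_derive t 1 f d -> 0 < delta ->
  (forall h, 0 < h < delta -> f (t + h) = f t) -> d = 0.
Proof.
move=> [df dE] delta0 H; apply/eqP; apply: contraT => d0.
have nd : 0 < `|d| / 2 by rewrite divr_gt0 // normr_gt0.
have C : h^-1 *: (f (h *: 1 + t) - f t) @[h --> 0^'] --> d by rewrite -dE; exact: df.
move/cvgrPdist_lt : C => /(_ _ nd)[e /= e0 He].
pose h := Num.min e delta / 2.
have h0 : 0 < h by rewrite divr_gt0 // lt_min e0.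
have hm : h < Num.min e delta by rewrite /h ltr_pdivrMr // ltr_pMr ?lt_min ?e0 // ltr1n.
move: hm; rewrite lt_min => /andP[he hd].
have := He h; rewrite /ball_/= sub0r normrN gtr0_norm // he gt_eqF // => /(_ isT isT).
have -> : h *: (1 : R) = h by exact: mulr1.
rewrite [h + t]addrC H ?h0 // subrr scaler0 subr0 ltNge ler_pdivrMr //.
by rewrite ler_peMr // ler1n.
Qed.

End curves.

(** * Geodesics of the gradient metric *)

Section gradient_metric.
Context {R : realType} {n : nat}.
Implicit Types (u v x : 'rV[R]_n) (ell : 'rV[R]_n -> R).

(** Cauchy-Schwarz in dimension [n + 1] for the pairs [(u, y)] and [(w, z)]: the squared norm of
    [p (u, y) - K (w, z)] equals [K (K E - p^2)]. *)
Lemma dotp_pair_CS u w (y z : R) : (dotp w u + y * z) ^+ 2 <=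
  (dotp u u + y ^+ 2) * (dotp w w + z ^+ 2).
Proof.
set p := dotp w u + _; set K := dotp u u + _; set E := dotp w w + _.
have K0 : 0 <= K by rewrite addr_ge0 ?dotp_ge0 ?sqr_ge0.
have [K00|Kn] := eqVneq K 0.
  have [/eqP u0 /eqP y0] : dotp u u == 0 /\ y ^+ 2 == 0.
    by apply/andP; rewrite -paddr_eq0 ?dotp_ge0 ?sqr_ge0 // -/K K00.
  move/eqP: u0; rewrite dotp_eq0 => /eqP u0; move/eqP: y0; rewrite sqrf_eq0 => /eqP y0.
  by rewrite /p u0 y0 dotp0r mul0r add0r expr0n K00 mul0r.
have Kp : 0 < K by rewrite lt_def Kn.
rewrite -subr_ge0 -(pmulr_rge0 _ Kp).
have : 0 <= dotp (p *: u - K *: w) (p *: u - K *: w) + (p * y - K * z) ^+ 2.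
  by rewrite addr_ge0 ?dotp_ge0 ?sqr_ge0.
rewrite !(dotpDl, dotpDr, dotpNl, dotpNr, dotpZl, dotpZr) (dotpC u w).
by congr (0 <= _); rewrite /K /E /p; ring.
Qed.

Lemma qform_grad_metric ell x u :
  qform (grad_metric ell x) u = dotp u u + dotp u (grad ell x) ^+ 2.
Proof.
rewrite /qform /grad_metric mulmxDr mulmxDl mulmx1 mxE mulmx_dotp; congr (_ + _).
rewrite mulmxA -mulmxA mxE big_ord1 mulmx_dotp.
have -> : (grad ell x *m u^T) 0 0 = dotp u (grad ell x) by rewrite mulmx_dotp dotpC.
by rewrite expr2.
Qed.

Lemma grad_metric_unitmx ell x : grad_metric ell x \in unitmx.
Proof.
apply: qform_neq0_unitmx => u u0; rewrite qform_grad_metric gt_eqF //.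
by rewrite ltr_pwDl ?dotp_gt0 ?sqr_ge0.
Qed.

Lemma derive_cst_mul (f g : 'rV[R]_n -> R) a x e :
  derivable f x e -> derivable g x e ->
  'D_e (cst a + f * g) x = 'D_e f x * g x + f x * 'D_e g x.
Proof.
move=> /derivableP df /derivableP dg.
have d := is_deriveD (is_derive_cst a x e) (is_deriveM df dg).
rewrite (@derive_val _ _ _ _ _ _ _ d) add0r /GRing.scale /= addrC.
by congr (_ + _); rewrite mulrC.
Qed.

Lemma dmetric_grad_metric ell l i j x : Ck 2 ell ->
  dmetric (grad_metric ell) l i j x =
    'D_(basis l) ('D_(basis i) ell) x * 'D_(basis j) ell x +
    'D_(basis i) ell x * 'D_(basis l) ('D_(basis j) ell) x.
Proof.
move=> Hell; rewrite /dmetric.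
have -> : (fun y => grad_metric ell y i j) =
    cst ((1%:M : 'M[R]_n) i j) + 'D_(basis i) ell * 'D_(basis j) ell.
  apply/funext => y; rewrite /grad_metric mxE; congr (_ + _).
  by rewrite mxE big_ord1 !mxE.
have di k : derivable ('D_(basis k) ell) x (basis l).
  by have [_ /(_ l)[]] := Hell k.
exact: derive_cst_mul.
Qed.

Lemma exchange_sum3 (F : 'I_n -> 'I_n -> 'I_n -> R) :
  \sum_l \sum_i \sum_j F i j l = \sum_l \sum_i \sum_j F i l j.
Proof.
rewrite exchange_big [RHS]exchange_big; apply: eq_bigr => i _ /=.
exact: exchange_big.
Qed.

(* With [H] the Hessian and [g] the gradient, the parenthesis is twice the
   Christoffel symbol of the first kind of [I + g g^T]. *)
Lemma christoffel_contraction (H : 'M[R]_n) (g v : 'rV[R]_n) :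
  \sum_l (2^-1 * \sum_i \sum_j
    ((H i j * g 0 l + g 0 j * H i l) + (H j i * g 0 l + g 0 i * H j l)
     - (H l i * g 0 j + g 0 i * H l j)) * v 0 i * v 0 j) * v 0 l =
  (\sum_i \sum_j H i j * v 0 i * v 0 j) * dotp v g.
Proof.
pose V i j l := v 0 i * v 0 j * v 0 l.
(* The weight [V] is symmetric in its indices, so relabelling turns each of the six sums into [S].
   Four carry a plus sign and two a minus sign; half of the total is [S]. *)
pose S := \sum_l \sum_i \sum_j H i j * g 0 l * V i j l.
have swapij F : \sum_l \sum_i \sum_j (F i j l : R) = \sum_l \sum_i \sum_j F j i l.
  by apply: eq_bigr => l _; rewrite exchange_big.
have S1 : \sum_l \sum_i \sum_j g 0 j * H i l * V i j l = S.
  rewrite (exchange_sum3 (fun i j l => g 0 j * H i l * V i j l)).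
  apply: eq_bigr => l _; apply: eq_bigr => i _; apply: eq_bigr => j _.
  rewrite /V; ring.
have S2 : \sum_l \sum_i \sum_j H j i * g 0 l * V i j l = S.
  rewrite swapij; apply: eq_bigr => l _; apply: eq_bigr => i _; apply: eq_bigr => j _.
  rewrite /V; ring.
have S3 : \sum_l \sum_i \sum_j g 0 i * H j l * V i j l = S.
  rewrite swapij -S1; apply: eq_bigr => l _; apply: eq_bigr => i _; apply: eq_bigr => j _.
  rewrite /V; ring.
have S4 : \sum_l \sum_i \sum_j H l i * g 0 j * V i j l = S.
  rewrite (exchange_sum3 (fun i j l => H l i * g 0 j * V i j l)) swapij.
  apply: eq_bigr => l _; apply: eq_bigr => i _; apply: eq_bigr => j _.
  rewrite /V; ring.
have S5 : \sum_l \sum_i \sum_j g 0 i * H l j * V i j l = S.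
  rewrite swapij -S4; apply: eq_bigr => l _; apply: eq_bigr => i _; apply: eq_bigr => j _.
  rewrite /V; ring.
transitivity (2^-1 * (S + S + (S + S) - (S + S))).
  rewrite -[X in _ = 2^-1 * (S + X + _ - _)]S1 -[X in _ = 2^-1 * (_ + (X + _) - _)]S2.
  rewrite -[X in _ = 2^-1 * (_ + (_ + X) - _)]S3 -[X in _ = 2^-1 * (_ - (X + _))]S4.
  rewrite -[X in _ = 2^-1 * (_ - (_ + X))]S5 /S -!big_split -sumrB /= mulr_sumr.
  apply: eq_bigr => l _; rewrite -!big_split -sumrB /= -mulrA mulr_suml; congr (_ * _).
  apply: eq_bigr => i _; rewrite -!big_split -sumrB /= mulr_suml.
  apply: eq_bigr => j _; rewrite /V; ring.
have -> : 2^-1 * (S + S + (S + S) - (S + S)) = S by lra.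
rewrite /S /dotp mulr_sumr; apply: eq_bigr => l _; rewrite mulr_suml.
apply: eq_bigr => i _; rewrite mulr_suml; apply: eq_bigr => j _.
rewrite /V; ring.
Qed.

Lemma qform_hess ell x v :
  qform (hess ell x) v = \sum_i v 0 i * dotp v (grad ('D_(basis i) ell) x).
Proof.
rewrite qformE exchange_big; apply: eq_bigr => j _ /=; rewrite mulr_sumr.
by apply: eq_bigr => i _; rewrite !mxE; ring.
Qed.

Section one_geodesic.
Variables (ell : 'rV[R]_n -> R) (J : set R) (theta : R -> 'rV[R]_n).
Hypotheses (Hell : Ck 2 ell) (geo : geodesic (grad_metric ell) J theta).

Let v := derive1 theta.
Let slope t := dotp (v t) (grad ell (theta t)).

Let is_derive_ell t : J t -> is_derive t 1 (fun s => ell (theta s)) (slope t).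
Proof.
have [_ _ H] := geo; move=> /H[dth _ _].
by apply: is_derive_chain dth; exact: (CkS Hell).
Qed.

(** Product rule, then the chain rule on each partial derivative of [ell]. Where the gradient
    vanishes only the Hessian form remains, which later gives strictness. *)
Lemma is_derive_slope t : J t -> is_derive t 1 slope
  (dotp (derive1 v t) (grad ell (theta t)) + qform (hess ell (theta t)) (v t)).
Proof.
have [_ _ H] := geo; move=> /H[dth dv _].
have -> : qform (hess ell (theta t)) (v t) =
    dotp (v t) (\row_i dotp (v t) (grad ('D_(basis i) ell) (theta t))).
  by rewrite qform_hess; apply: eq_bigr => i _; rewrite mxE.
apply: is_derive_dotp => i; first exact: is_derive_coord.
rewrite mxE; under eq_fun do rewrite mxE.
by apply: (@is_derive_chain _ _ ('D_(basis i) ell)) => //; case: (Hell i).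
Qed.

(** Pairing the geodesic equation with [v G] leaves, by [christoffel_contraction], minus the slope
    times the Hessian form; this cancels the Hessian term of [is_derive_slope]. *)
Lemma is_derive_energy t : J t ->
  is_derive t 1 (fun s => dotp (v s) (v s) + slope s ^+ 2) 0.
Proof.
move=> Jt; have [_ _ H] := geo; have [dth dv geq] := H t Jt.
have d1 : is_derive t 1 (fun s => dotp (v s) (v s))
    (dotp (derive1 v t) (v t) + dotp (v t) (derive1 v t)).
  by apply: is_derive_dotp => i; exact: is_derive_coord.
have d2 := is_derive_slope Jt.
have -> : (fun s => dotp (v s) (v s) + slope s ^+ 2) =
  (fun s => dotp (v s) (v s)) + slope * slope by apply/funext => s; rewrite /= expr2.
apply: (is_derive_eq (is_deriveD d1 (is_deriveM d2 d2))).
rewrite /GRing.scale /= (dotpC (derive1 v t) (v t)).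
pose x := theta t; pose g := grad ell x; pose Gm := grad_metric ell x.
pose Hs : 'M[R]_n := hess ell x.
(* [c] is the first-kind Christoffel symbol contracted twice with the velocity, so the geodesic
   equation reads [G v' = - c]. *)
pose c := \row_l (2^-1 * \sum_i \sum_j
  (dmetric (grad_metric ell) i j l x + dmetric (grad_metric ell) j i l x
    - dmetric (grad_metric ell) l i j x) * v t 0 i * v t 0 j).
have Ev : (derive1 v t)^T = - (invmx Gm *m c^T).
  apply/matrixP => k o; rewrite (ord1 o) !mxE; apply/eqP; rewrite -addr_eq0; apply/eqP.
  rewrite -[RHS](geq k); congr (_ + _); under eq_bigr do rewrite !mxE.
  transitivity (\sum_i \sum_j \sum_l 2^-1 * (invmx Gm k l * (dmetric (grad_metric ell) i j l x + dmetric (grad_metric ell) j i l x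
    - dmetric (grad_metric ell) l i j x)) * v t 0 i * v t 0 j); last first.
    apply: eq_bigr => i _; apply: eq_bigr => j _.
    by rewrite /christoffel !mulr_sumr !mulr_suml.
  transitivity (\sum_l \sum_i \sum_j 2^-1 * (invmx Gm k l * (dmetric (grad_metric ell) i j l x + dmetric (grad_metric ell) j i l x
    - dmetric (grad_metric ell) l i j x)) * v t 0 i * v t 0 j).
    apply: eq_bigr => l _; rewrite !mulr_sumr; apply: eq_bigr => i _.
    by rewrite !mulr_sumr; apply: eq_bigr => j _; ring.
  rewrite exchange_big; apply: eq_bigr => i _; exact: exchange_big.
have E1 : dotp (v t) (derive1 v t) + slope t * dotp (derive1 v t) g =
    - (qform Hs (v t) * slope t).
  transitivity ((v t *m Gm *m (derive1 v t)^T) 0 0).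
    rewrite /Gm /grad_metric mulmxDr mulmxDl mulmx1 mxE mulmx_dotp; congr (_ + _).
    rewrite mulmxA -mulmxA mxE big_ord1 mulmx_dotp.
    have -> : (grad ell x *m (derive1 v t)^T) 0 0 = dotp (derive1 v t) g by rewrite mulmx_dotp dotpC.
    by [].
  rewrite Ev mulmxN -mulmxA mulKVmx ?grad_metric_unitmx // mxE mulmx_dotp; congr (- _).
  rewrite qformE -(christoffel_contraction Hs g (v t)).
  rewrite /dotp; apply: eq_bigr => l _; rewrite mulrC mxE; congr (_ * _ * _).
  apply: eq_bigr => i _; apply: eq_bigr => j _; rewrite !dmetric_grad_metric // /Hs /g.
  by rewrite !mxE.
move: E1; rewrite -/x -/g -/Hs; set a := dotp _ _; set b := dotp _ _; set q := qform _ _; set s := slope t.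
move=> E1.
have -> : a + a + (s * (b + q) + s * (b + q)) = 2 * (a + s * b) + 2 * (q * s) by ring.
by rewrite E1; ring.
Qed.

Lemma geodesic_energy a b : J a -> J b ->
  dotp (v a) (v a) + slope a ^+ 2 = dotp (v b) (v b) + slope b ^+ 2.
Proof.
have [_ iJ _] := geo; move=> Ja Jb.
exact: (derive0_cst iJ is_derive_energy Ja Jb).
Qed.

(* [t |-> (theta t, ell (theta t))] runs on the graph of [ell] with constant
   Euclidean speed, so its chords are at most as long as its arcs. *)
Lemma geodesic_chord a b : a <= b -> J a -> J b ->
  dotp (theta b - theta a) (theta b - theta a) + (ell (theta b) - ell (theta a)) ^+ 2
  <= (b - a) ^+ 2 * (dotp (v a) (v a) + slope a ^+ 2).
Proof.
move=> ab Ja Jb; have [_ iJ H] := geo.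
set x := theta b - theta a; set y := ell (theta b) - ell (theta a).
(* [phi] projects the lifted curve on its own chord [(x, y)]. Its increment is the squared chord
   length [K], which the mean value theorem writes as [p * (b - a)], with [p] the inner product of
   the chord and the lifted velocity at [t]. *)
pose phi s := dotp (theta s) x + y * ell (theta s).
have Jab t : t \in `[a, b]%R -> J t by rewrite in_itv/=; exact: iJ.
have dphi t : J t -> is_derive t 1 phi (dotp (v t) x + y * slope t).
  move=> Jt; have [dth _ _] := H t Jt; have d2 := is_derive_ell Jt.
  have d1 : is_derive t 1 (fun s => dotp (theta s) x) (dotp (v t) x + dotp (theta t) 0).
    apply: (@is_derive_dotp _ _ theta (fun=> x)) => i; first exact: is_derive_coord.
    by rewrite [X in is_derive _ _ _ X]mxE; exact: is_derive_cst.
  rewrite /phi; have -> : (fun s => dotp (theta s) x + y * ell (theta s)) =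
    (fun s => dotp (theta s) x) + y \*: (fun s => ell (theta s)) by [].
  by apply: (is_derive_eq (is_deriveD d1 (is_deriveZ y d2))); rewrite dotp0r addr0.
have cphi : {within `[a, b], continuous phi}.
  by apply: derivable_within_continuous => t /Jab /dphi[].
have [t tab] := @MVT_segment _ phi _ a b ab
  (fun t tab => dphi t (Jab t (subset_itv_oo_cc tab))) cphi.
have -> : phi b - phi a = dotp x x + y ^+ 2.
  rewrite /phi {3}/x dotpDl dotpNl /y; ring.
rewrite (geodesic_energy Ja (Jab _ tab)).
set K := dotp x x + _; set p := dotp (v t) x + _; set E := dotp (v t) (v t) + _ => KE.
have K0 : 0 <= K by rewrite addr_ge0 ?dotp_ge0 ?sqr_ge0.
have ba0 : 0 <= b - a by rewrite subr_ge0.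
have [K00|Kp] := eqVneq K 0.
  by rewrite K00 mulr_ge0 ?sqr_ge0 // addr_ge0 ?dotp_ge0 ?sqr_ge0.
have {}Kp : 0 < K by rewrite lt_def Kp.
have pE : p ^+ 2 <= K * E by exact: dotp_pair_CS.
(* Now [K^2 = (p (b - a))^2 <= K E (b - a)^2], and a factor [K] cancels. *)
rewrite -(ler_pM2l Kp); apply: (@le_trans _ _ ((p * (b - a)) ^+ 2)); first by rewrite -KE expr2.
rewrite exprMn [leRHS](_ : _ = K * E * (b - a) ^+ 2); last by ring.
by rewrite ler_wpM2r ?sqr_ge0.
Qed.

End one_geodesic.
End gradient_metric.

(** * Exponential maps of the gradient metric and of the Euclidean metric *)

Section exponential_map.
Context {R : realType} {n : nat}.
Implicit Types (v x th : 'rV[R]_n) (ell : 'rV[R]_n -> R) (G : 'rV[R]_n -> 'M[R]_n).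

Lemma ExpP G x v : Exp G x v = x \/
  exists (J : set R) (theta : R -> 'rV[R]_n),
    [/\ geodesic G J theta, J 0 /\ J 1, theta 0 = x,
        derive1 theta 0 = v & theta 1 = Exp G x v].
Proof. by rewrite /Exp; case: xgetP => [y _ H|]; [right|left]. Qed.

Lemma grad_max ell th : Ck 1 ell -> (forall x, ell x <= ell th) -> grad ell th = 0.
Proof.
move=> Hell Hmax; apply/rowP => i; rewrite !mxE.
have d0 y : derivable ell y (basis i) by case: (Hell i).
pose f s := ell (s *: basis i + th).
have df (t : R) : is_derive t 1 f ('D_(basis i) ell (t *: basis i + th)).
  exact: is_derive_line.
have i0 : (0 : R) \in `]-1, 1[%R by rewrite in_itv/= ltrN10 ltr01.
have [] := @derive1_at_max _ f (-1) 1 0 (ltW (lt_trans (ltrN10 _) ltr01))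
  (fun t _ => @ex_derive _ _ _ _ _ _ _ (df t)) i0 _.
  by move=> t _; rewrite /f scale0r add0r.
by case: (df 0) => _; rewrite scale0r add0r => -> _ ->.
Qed.

(** Expanding the squared norm of [(1 - s) p - s q] proves this triangle inequality without square
    roots. Here [p] and [q] will be the chords of a geodesic over [[0, s]] and [[s, 1]]. *)
Lemma dotp_chord_eq (p q : 'rV[R]_n) (s E : R) : 0 < s < 1 ->
  dotp (p + q) (p + q) = E -> dotp q q <= (1 - s) ^+ 2 * E ->
  s ^+ 2 * E <= dotp p p.
Proof.
move=> /andP[s0 s1]; have := dotp_ge0 ((1 - s) *: p - s *: q).
rewrite !(dotpDl, dotpDr, dotpNl, dotpNr, dotpZl, dotpZr) (dotpC q p).
set A := dotp p p; set B := dotp p q; set C := dotp q q => H EE HC.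
have H1 : 0 <= (1 - s) * A + s * C - s * (1 - s) * E.
  by rewrite -EE; move: H; congr (0 <= _); ring.
have H2 : s * C <= s * ((1 - s) ^+ 2 * E) by rewrite ler_wpM2l // ltW.
have t0 : 0 < 1 - s by rewrite subr_gt0.
rewrite -(ler_pM2l t0) -subr_ge0.
have -> : (1 - s) * A - (1 - s) * (s ^+ 2 * E) =
  ((1 - s) * A + s * C - s * (1 - s) * E) + (s * ((1 - s) ^+ 2 * E) - s * C) by ring.
by rewrite addr_ge0 // subr_ge0.
Qed.

(** The chord inequality over [[0, 1]], with zero initial slope since the gradient vanishes at [th].
    At the default value of [Exp] the left side is 0. *)
Lemma Exp_grad_metric_arc ell th v : Ck 2 ell -> grad ell th = 0 ->
  dotp (Exp (grad_metric ell) th v - th) (Exp (grad_metric ell) th v - th) +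
    (ell (Exp (grad_metric ell) th v) - ell th) ^+ 2 <= dotp v v.
Proof.
move=> Hell g0; have [->|[J [theta [geo [J0 J1] th0 v0 <-]]]] := ExpP (grad_metric ell) th v.
  by rewrite !subrr dotp0l expr0n addr0 dotp_ge0.
have := geodesic_chord Hell geo ler01 J0 J1.
by rewrite th0 v0 g0 dotp0r expr0n addr0 subr0 expr1n mul1r.
Qed.

Lemma Exp_grad_metric_lt ell th v : Ck 2 ell -> grad ell th = 0 ->
  v != 0 -> qform (hess ell th) v != 0 ->
  dotp (Exp (grad_metric ell) th v - th) (Exp (grad_metric ell) th v - th) < dotp v v.
Proof.
move=> Hell g0 v0 Hv; have [->|[J [theta [geo [J0 J1] th0 dth0 <-]]]] := ExpP (grad_metric ell) th v.
  by rewrite subrr dotp0l dotp_gt0.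
set E := dotp v v; rewrite ltNge; apply: contra Hv => Ege.
have [_ iJ _] := geo.
have J01 s : 0 <= s <= 1 -> J s by exact: iJ.
have chord0 s : 0 <= s <= 1 -> dotp (theta s - th) (theta s - th) +
    (ell (theta s) - ell th) ^+ 2 <= s ^+ 2 * E.
  move=> s01; have /andP[s0 _] := s01.
  have := geodesic_chord Hell geo s0 J0 (J01 _ s01).
  by rewrite th0 dth0 g0 dotp0r expr0n addr0 subr0.
have chord1 s : 0 <= s <= 1 -> dotp (theta 1 - theta s) (theta 1 - theta s) <= (1 - s) ^+ 2 * E.
  move=> s01; have /andP[_ s1] := s01.
  have := geodesic_chord Hell geo s1 (J01 _ s01) J1.
  rewrite (geodesic_energy Hell geo (J01 _ s01) J0) th0 dth0 g0 dotp0r expr0n addr0.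
  by apply: le_trans; rewrite lerDl sqr_ge0.
have Eeq : dotp (theta 1 - th) (theta 1 - th) = E.
  apply/le_anti/andP; split => //; have := chord0 1.
  rewrite ler01 lexx expr1n mul1r => /(_ isT); apply: le_trans.
  by rewrite lerDl sqr_ge0.
(* At full length the chord bounds leave no slack: by time [s] the curve is already at distance [s]
   times [|v|] from [th], so [chord0] forces the change of [ell] to be 0. *)
have ell_cst s : 0 <= s <= 1 -> ell (theta s) = ell th.
  move=> /andP[]; rewrite le_eqVlt => /predU1P[<- _|s0]; first by rewrite th0.
  move=> s1; have s01 : 0 <= s <= 1 by rewrite (ltW s0).
  have Hs : s ^+ 2 * E <= dotp (theta s - th) (theta s - th).
    move: s1; rewrite le_eqVlt => /predU1P[->|s1]; first by rewrite expr1n mul1r Eeq.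
    apply: (@dotp_chord_eq (theta s - th) (theta 1 - theta s)).
    - by rewrite s0.
    - by rewrite addrC subrKA.
    - exact: chord1.
  have := chord0 s s01; rewrite -lerBrDl => /le_trans/(_ _).
  move=> /(_ 0); rewrite subr_le0 => /(_ Hs) H; apply/eqP; rewrite -subr_eq0 -sqrf_eq0.
  by rewrite eq_le H sqr_ge0.
(* [w] is the derivative of [ell] along the curve. It vanishes on [[0, 1)], hence so does its
   derivative at 0, which is the Hessian form of [v]. *)
pose w s := dotp (derive1 theta s) (grad ell (theta s)).
have w0 s : 0 <= s < 1 -> w s = 0.
  move=> /andP[s0 s1].
  have s01 : 0 <= s <= 1 by rewrite s0 ltW.
  have [_ _ /(_ s (J01 _ s01))[dth _ _]] := geo.
  have d := is_derive_chain (CkS Hell) dth.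
  apply: (is_derive_right_cst d (delta := 1 - s)); first by rewrite subr_gt0.
  move=> h /andP[h0 hs]; rewrite !ell_cst //.
  by rewrite addr_ge0 ?(ltW h0) //= addrC -lerBrDr ltW.
have d := is_derive_slope Hell geo J0.
have wc h : 0 < h < 1 -> w (0 + h) = w 0.
  by move=> /andP[h0 h1]; rewrite add0r !w0 ?lexx ?ltr01 ?(ltW h0).
have := is_derive_right_cst d ltr01 wc.
by rewrite th0 g0 dth0 dotp0r add0r => ->.
Qed.

Lemma christoffel_euclidean k i j x : christoffel (@euclidean_metric R n) k i j x = 0.
Proof.
have D l i' j' y : dmetric (@euclidean_metric R n) l i' j' y = 0.
  by rewrite /dmetric /euclidean_metric derive_cst.
rewrite /christoffel big1 ?mulr0 // => l _.
by rewrite !D addr0 subr0 mulr0.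
Qed.

Lemma geodesic_line x v :
  geodesic (@euclidean_metric R n) setT (fun t => t *: v + x) /\
  forall t, derive1 (fun t : R => t *: v + x) t = v.
Proof.
have d (t : R) : is_derive t 1 (fun t : R => t *: v + x) v.
  have dd i j : is_derive t 1 (fun t : R => (t *: v + x) i j) (v i j).
    have -> : (fun t : R => (t *: v + x) i j) = (fun t : R => t * v i j + x i j).
      by apply/funext => s; rewrite !mxE.
    have e := is_deriveD (is_deriveM (is_derive_id t 1) (is_derive_cst (v i j) t 1)) (is_derive_cst (x i j) t (1 : R)).
    by apply: (is_derive_eq e); rewrite scaler0 add0r addr0 /GRing.scale /= mulr1.
  have dm : derivable (fun t : R => t *: v + x) t 1.
    by apply/derivable_mxP => i j; case: (dd i j).
  split => //; rewrite derive_mx //; apply/matrixP => i j; rewrite mxE.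
  by case: (dd i j).
have D t : derive1 (fun t : R => t *: v + x) t = v by rewrite derive1E; case: (d t).
split => //; split; [exact: openT|by []|move=> t _ /=].
have -> : derive1 (fun t : R => t *: v + x) = cst v by apply/funext.
split; [by case: (d t)|exact: derivable_cst|move=> k].
rewrite derive1_cst mxE add0r big1 // => i _; rewrite big1 // => j _.
by rewrite christoffel_euclidean !mul0r.
Qed.

(** The straight line makes the set of candidate endpoints nonempty, and zero Christoffel symbols
    give every candidate geodesic constant velocity, hence the same endpoint. *)
Lemma Exp_euclidean x v : Exp euclidean_metric x v = x + v.
Proof.
rewrite /Exp; case: xgetP => [y -> [J [theta [geo [J0 J1] <- <- <-]]]|]; last first.
  move=> /(_ (x + v)) []; have [geo dv] := geodesic_line x v.
  exists setT, (fun t => t *: v + x).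
  by split => //; rewrite ?scale0r ?add0r // scale1r addrC.
have [_ iJ H] := geo; apply/rowP => k; rewrite mxE.
set v0 := derive1 theta 0.
have dvk s : J s -> is_derive s 1 (fun t => derive1 theta t 0 k) 0.
  move=> Js; have [_ dv /(_ k)] := H s Js.
  rewrite big1 ?addr0 => [E|i _]; first exact: is_derive_eq (is_derive_coord k dv) E.
  by rewrite big1 // => j _; rewrite christoffel_euclidean !mul0r.
have vc t : J t -> derive1 theta t 0 k = v0 0 k.
  by move=> Jt; exact: (derive0_cst iJ dvk Jt J0).
have d t : J t -> is_derive t 1 (fun s => theta s 0 k - s * v0 0 k) 0.
  move=> Jt; have [dth _ _] := H t Jt.
  have d1 := is_derive_coord k dth.
  have d2 := is_deriveM (is_derive_id t 1) (is_derive_cst (v0 0 k) t (1 : R)).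
  apply: (is_derive_eq (is_deriveB d1 d2)).
  by rewrite vc // scaler0 add0r /GRing.scale /= mulr1 subrr.
have := derive0_cst iJ d J1 J0; rewrite mul0r mul1r subr0 => <-.
by rewrite subrK.
Qed.

End exponential_map.

(** * Lebesgue measure on R^n *)

Section image_measure.
Context d1 d2 (T1 : measurableType d1) (T2 : measurableType d2) (R : realType).
Variables (m : {measure set T1 -> \bar R}) (f : T1 -> T2).
Hypothesis mf : measurable_fun setT f.

(* [pushforward] carries its measure structure only given [mf], which type
   inference cannot supply. *)
Definition image_measure : {measure set T2 -> \bar R} :=
  measure_function_pushforward__canonical__measure_function_Measure m mf.

Lemma ge0_integral_image_measure (g : T2 -> \bar R) D : measurable D ->
  measurable_fun setT g -> (forall y, 0 <= g y)%E ->
  (\int[image_measure]_(y in D) g y = \int[m]_(x in f @^-1` D) g (f x))%E.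
Proof.
move=> mD mg g0; rewrite -(ge0_integral_pushforward mf m mD) //.
by apply: measurable_funS mg.
Qed.

End image_measure.

Section borel_sets.
Context {R : realType}.

Definition box n (c : 'rV[R]_n) (r : R) : set 'rV[R]_n :=
  [set x | forall i, `|x 0 i - c 0 i| < r].

Lemma measurable_box n (c : 'rV[R]_n) r : measurable (box c r).
Proof.
have -> : box c r = \bigcap_(i in [set: 'I_n]) [set x : 'rV[R]_n | `|x 0 i - c 0 i| < r].
  by apply/seteqP; split => [x H i _|x H i]; exact: H.
apply: fin_bigcap_measurable => // i _.
rewrite (_ : [set x | _] = (fun x : 'rV[R]_n => x 0 i) @^-1` ball (c 0 i) r).
  rewrite -[X in measurable X]setTI; apply: measurable_coor => //.
  by rewrite ball_itv; exact: measurable_itv.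
by apply/funext => x /=; rewrite /ball /= distrC.
Qed.

(** The sigma-algebra is generated by the coordinates, so an open set has to be exhibited as a
    countable union of boxes. *)
Lemma measurable_open_rV n (U : set 'rV[R]_n) : open U -> measurable U.
Proof.
move=> oU.
(* Boxes have rational centres and radii [1 / (k + 1)]. Those not contained in [U] are replaced by
   the empty set, so the union runs over a countable type. *)
pose B (p : 'rV[rat]_n * nat) := box (map_mx (@ratr R) p.1) (p.2.+1%:R^-1).
have -> : U = \bigcup_p (if `[< B p `<=` U >] then B p else set0).
  apply/seteqP; split => [x Ux|x [p _]]; last first.
    by case: ifPn => // /asboolP H /H.
  have /nbhs_ballP[e /= e0 He] : nbhs x U by exact: open_nbhs_nbhs.
  pose k := Num.truncn (e / 2)^-1.
  have ke : k.+1%:R^-1 < e / 2.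
    rewrite invf_plt ?posrE ?divr_gt0 // -(mulr1n k.+1%:R).
    by rewrite mulr1n truncnS_gt.
  have k0 : 0 < k.+1%:R^-1 :> R by rewrite invr_gt0.
  have Hq i : {q : rat | `|x 0 i - ratr q| < k.+1%:R^-1}.
    apply: cid; have : x 0 i - k.+1%:R^-1 < x 0 i + k.+1%:R^-1 by rewrite ltrD2l gtrN.
    move=> /rat_in_itvoo[q]; rewrite in_itv/= => qi; exists q.
    by rewrite ltr_distlC.
  pose c : 'rV[rat]_n := \row_i sval (Hq i).
  have cx i : `|x 0 i - map_mx (@ratr R) c 0 i| < k.+1%:R^-1.
    by rewrite !mxE; exact: svalP (Hq i).
  exists (c, k) => //=; rewrite asboolT; first exact: cx.
  move=> y By; apply: He; rewrite -ball_normE /=.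
  apply: (@le_lt_trans _ _ (k.+1%:R^-1 + k.+1%:R^-1)).
    apply: norm_le_coord => [|i]; first by rewrite addr_ge0 // ltW.
    rewrite mxE [(- y) 0 i]mxE -(subrKA (map_mx (@ratr R) c 0 i)).
    apply: (le_trans (ler_normD _ _)); rewrite lerD ?ltW //.
    by rewrite distrC; exact: By.
  by rewrite (splitr e) ltrD.
apply: countable_bigcupT_measurable; first exact: countableP.
move=> p; case: ifP => _ //; exact: measurable_box.
Qed.

Lemma continuous_measurable_rV n (f : 'rV[R]_n -> R) :
  continuous f -> measurable_fun setT f.
Proof.
move=> /continuousP cf; apply: (measurability _ (RGenOpens.measurableE R)).
move=> _ [_ [a [b ->] <-]]; rewrite setTI; apply: measurable_open_rV.
exact/cf/interval_open.
Qed.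

End borel_sets.

Section lebesgue.
Context {R : realType}.

Lemma measurable_affine_rV n (k : R) (a : 'rV[R]_n) :
  measurable_fun setT (fun x : 'rV[R]_n => k *: x + a).
Proof.
apply: measurable_fun_rVP => i.
rewrite (_ : (fun _ => _) = (fun x : 'rV[R]_n => k * x 0 i + a 0 i)); last first.
  by apply/funext => x; rewrite !mxE.
apply: measurable_funD => //; apply: measurable_funM => //; exact: measurable_coor.
Qed.

Lemma measurable_affine (k a : R) :
  measurable_fun setT (fun x : measurableTypeR R => k * x + a : measurableTypeR R).
Proof. by apply: measurable_funD => //; exact: measurable_funM. Qed.

(** The right side is a measure in [A], so it suffices to compare both sides on half-open
    intervals. *)
Lemma lebesgue_affine (k a : R) (A : set (measurableTypeR R)) : 0 < k -> measurable A ->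
  lebesgue_measure A =
    (k%:E * lebesgue_measure ((fun x : measurableTypeR R => (k * x + a)%R : measurableTypeR R) @^-1` A))%E.
Proof.
move=> k0 mA.
rewrite -[RHS]/(mscale (NngNum (ltW k0)) (image_measure (@lebesgue_measure R) (measurable_affine k a)) A).
apply: lebesgue_measure_unique => // _ [[x y] _ <-].
pose I := `](x - a) / k, (y - a) / k]%classic.
rewrite [RHS](_ : _ = k%:E * lebesgue_measure I)%E /I; last first.
  rewrite /mscale /= /pushforward; congr (_ * lebesgue_measure _)%E.
  apply/seteqP; split => t /=; rewrite !in_itv /=.
    by rewrite ltr_pdivrMr // ler_pdivlMr // ltrBlDr lerBrDr ![k * _]mulrC.
  by rewrite ltr_pdivrMr // ler_pdivlMr // ltrBlDr lerBrDr ![k * _]mulrC.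
rewrite !lebesgue_measure_itv /= !lte_fin ltr_pM2r ?invr_gt0 // ltrD2r.
case: ifP => _; last by rewrite mule0.
by rewrite -!EFinB -EFinM; congr EFin; field; rewrite gt_eqF.
Qed.

(** Induction on the dimension by uniqueness of the product measure: its image under [psi], scaled
    by [k ^ n.+1], has the right value on rectangles. *)
Lemma leb_affine n (k : R) (a : 'rV[R]_n) (A : set 'rV[R]_n) : 0 < k -> measurable A ->
  leb R n A = ((k ^+ n)%:E * leb R n ((fun x => (k *: x + a)%R) @^-1` A))%E.
Proof.
move=> k0; elim: n a A => [|n IH] a A mA.
  rewrite expr0 mul1e /= (_ : _ @^-1` A = A) //.
  by apply/funext => x /=; rewrite (_ : k *: x + a = x) //; apply/rowP => -[].
pose ua := unconsrV a.
pose psi (p : measurableTypeR R * 'rV[R]_n) : measurableTypeR R * 'rV[R]_n :=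
  (k * p.1 + ua.1, k *: p.2 + ua.2).
have mpsi : measurable_fun setT psi.
  apply/measurable_fun_pairP; split.
    exact: (measurableT_comp (measurable_affine k ua.1) measurable_fst).
  exact: (measurableT_comp (measurable_affine_rV k ua.2) measurable_snd).
have kn : 0 <= k ^+ n.+1 by rewrite exprn_ge0 // ltW.
have mX : measurable (@consrV R n @^-1` A).
  by rewrite -[X in measurable X]setTI; exact: measurable_consrV.
have -> : leb R n.+1 A = (@lebesgue_measure R \x leb R n)%E (@consrV R n @^-1` A) by [].
rewrite (@product_measure_unique _ _ _ _ _ (@lebesgue_measure R) (leb R n)
  (mscale (NngNum kn) (image_measure (@lebesgue_measure R \x leb R n)%E mpsi))) //.
- rewrite /mscale /= /pushforward; congr (_ * _)%E.
  rewrite /leb_step /pushforward; congr ((_ \x _)%E _).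
  apply/funext => -[s y] /=; congr (A _); apply/rowP => i; rewrite /consrV /= !mxE.
  by case: splitP => j ij; rewrite !mxE;
    rewrite ?(ord1 j) ?eqxx ?mulr1n; do ?congr (_ + a 0 _); apply: val_inj => /=; rewrite ij ?(ord1 j).
- move=> A1 A2 mA1 mA2.
  rewrite -[LHS]/((k ^+ n.+1)%:E * (@lebesgue_measure R \x leb R n) (psi @^-1` (A1 `*` A2)))%E.
  have -> : psi @^-1` (A1 `*` A2) = ((fun x : measurableTypeR R => k * x + ua.1 : measurableTypeR R) @^-1` A1)
    `*` ((fun x => k *: x + ua.2) @^-1` A2) by [].
  have m1 : measurable ((fun x : measurableTypeR R => k * x + ua.1 : measurableTypeR R) @^-1` A1).
    by rewrite -[X in measurable X]setTI; exact: measurable_affine.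
  have m2 : measurable ((fun x : 'rV[R]_n => k *: x + ua.2) @^-1` A2).
    by rewrite -[X in measurable X]setTI; exact: measurable_affine_rV.
  rewrite product_measure1E //.
  have E1 := lebesgue_affine ua.1 k0 mA1; have E2 := IH ua.2 A2 mA2.
  transitivity ((k%:E * lebesgue_measure ((fun x : measurableTypeR R => (k * x + ua.1)%R : measurableTypeR R) @^-1` A1)) *
    ((k ^+ n)%:E * leb R n ((fun x => (k *: x + ua.2)%R) @^-1` A2)))%E.
    by rewrite exprS EFinM -!muleA; congr (_ * _)%E; rewrite muleCA.
  by congr (_ * _)%E; exact: esym.
Qed.

Lemma consrV_0 n (p : R * 'rV[R]_n) : consrV p 0 0 = p.1.
Proof. exact: (congr1 fst (consrVK p)). Qed.

Lemma consrV_lift n (p : R * 'rV[R]_n) i : consrV p 0 (lift 0 i) = p.2 0 i.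
Proof.
have := congr1 (fun q : R * 'rV[R]_n => q.2 0 i) (consrVK p).
by rewrite [X in X = _]mxE.
Qed.

Lemma leb_box n (c : 'rV[R]_n) (r : R) : 0 < r -> leb R n (box c r) = ((r *+ 2) ^+ n)%:E.
Proof.
move=> r0; elim: n c => [|n IH] c.
  by rewrite /= diracE mem_set // => -[].
have -> : leb R n.+1 (box c r) = (@lebesgue_measure R \x leb R n)%E (@consrV R n @^-1` box c r) by [].
have -> : @consrV R n @^-1` box c r = ball (c 0 0) r `*` box (unconsrV c).2 r.
  apply/seteqP; split => -[s y].
    move=> H; split => /= [|i]; first by have := H 0; rewrite consrV_0 distrC.
    by have := H (lift 0 i); rewrite consrV_lift /= !mxE.
  move=> [/= H1 H2] i; case: (unliftP 0 i) => [j|] ->.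
    by have := H2 j; rewrite consrV_lift /= !mxE.
  by rewrite consrV_0 distrC.
rewrite product_measure1E; [|by rewrite ball_itv; exact: measurable_itv|exact: measurable_box].
rewrite IH exprS EFinM; congr (_ * _)%E.
by apply: lebesgue_measure_ball; rewrite ltW.
Qed.

(** Small boxes shrink to the point. The dimension is positive since [leb R 0] is a Dirac mass. *)
Lemma leb_set1 n (c : 'rV[R]_n.+1) : leb R n.+1 [set c] = 0%E.
Proof.
have mc : measurable [set c].
  have -> : [set c] = ~` (~` [set c]) by rewrite setCK.
  apply: measurableC; apply: measurable_open_rV; rewrite openC.
  exact/accessible_closed_set1/hausdorff_accessible/norm_hausdorff.
apply/eqP; rewrite eq_le measure_ge0 andbT; apply/lee_addgt0Pr => e e0; rewrite add0e.
(* [2 r] is at most [e] and at most 1, so [(2 r)^(n + 1) <= 2 r <= e]. *)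
pose r := Num.min (e / 2) (2^-1).
have r0 : 0 < r by rewrite lt_min divr_gt0 //= invr_gt0.
apply: (@le_trans _ _ (leb R n.+1 (box c r))).
  apply: le_measure; rewrite ?inE //; first exact: measurable_box.
  by move=> _ -> i /=; rewrite subrr normr0.
rewrite leb_box // lee_fin exprS.
have r2 : r *+ 2 <= 1.
  by rewrite -mulr_natr -ler_pdivlMr // mul1r ge_min lexx orbT.
have re : r *+ 2 <= e by rewrite -mulr_natr -ler_pdivlMr // ge_min lexx.
have rr : 0 <= r *+ 2 by rewrite mulrn_wge0 // ltW.
by apply: le_trans re; rewrite ler_piMr // exprn_ile1.
Qed.

Lemma leb_open_gt0 n (U : set 'rV[R]_n) : open U -> U !=set0 -> (0 < leb R n U)%E.
Proof.
move=> oU [x Ux].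
have /nbhs_ballP[e /= e0 He] : nbhs x U by exact: open_nbhs_nbhs.
apply: (@lt_le_trans _ _ (leb R n (box x (e / 2)))).
  by rewrite leb_box ?divr_gt0 // lte_fin exprn_gt0 // mulrn_wgt0 // divr_gt0.
apply: le_measure; rewrite ?inE; [exact: measurable_box|exact: measurable_open_rV|].
move=> y By; apply: He; rewrite -ball_normE /=.
apply: (@le_lt_trans _ _ (e / 2)); last by rewrite ltr_pdivrMr // ltr_pMr // ltr1n.
apply: norm_le_coord => [|i]; first by rewrite ltW // divr_gt0.
by rewrite mxE [(- y) 0 i]mxE distrC ltW //; exact: By.
Qed.

End lebesgue.

(** * Probabilities with a continuous positive density *)

Section densities.
Context {R : realType} {n : nat}.
Implicit Types (P : probability 'rV[R]_n R) (f g : 'rV[R]_n -> R) (A : set 'rV[R]_n).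
Local Notation leb := (leb R n).

(** Continuity makes the density unique at every point, so that a log-density can be read off from
    the measure. *)
Definition has_density P f := [/\ continuous f, forall x, 0 < f x &
  forall A, measurable A -> P A = (\int[leb]_(x in A) (f x)%:E)%E].

Lemma continuous_expR_comp f (c : R) : continuous f -> continuous (fun x => expR (f x + c)).
Proof.
move=> cf x; apply: (@continuous_comp _ _ _ (fun x => f x + c) expR).
  by apply: continuousD; [exact: cf|exact: cst_continuous].
exact: continuous_expR.
Qed.

Lemma log_density_has_density P ell : continuous ell -> is_log_density P ell ->
  exists c, has_density P (fun x => expR (ell x + c)).
Proof.
move=> cell [c Hc]; exists c; split => // [|x]; last exact: expR_gt0.
exact: continuous_expR_comp.
Qed.

Lemma measurable_EFin_continuous f A : continuous f ->
  measurable_fun A (fun x => (f x)%:E).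
Proof.
move=> cf; apply/measurable_EFinP; apply: measurable_funS (continuous_measurable_rV cf) => //.
Qed.

Section one_density.
Variables (P : probability 'rV[R]_n R) (f : 'rV[R]_n -> R).
Hypothesis Pf : has_density P f.

Lemma density_le A k : measurable A -> (forall x, A x -> f x <= k) -> 0 <= k ->
  (P A <= k%:E * leb A)%E.
Proof.
have [cf f0 PE] := Pf; move=> mA fk k0; rewrite PE // -integral_cst //.
apply: ge0_le_integral => // [x _|]; first by rewrite lee_fin ltW.
exact: measurable_EFin_continuous.
Qed.

Lemma density_ge A k : measurable A -> (forall x, A x -> k <= f x) -> 0 <= k ->
  (k%:E * leb A <= P A)%E.
Proof.
have [cf f0 PE] := Pf; move=> mA fk k0; rewrite PE // -integral_cst //.
apply: ge0_le_integral => //; exact: measurable_EFin_continuous.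
Qed.

Lemma density_null A : measurable A -> leb A = 0%E -> P A = 0%E.
Proof.
have [cf f0 PE] := Pf; move=> mA A0; rewrite PE // null_set_integral //.
exact: measurable_EFin_continuous.
Qed.

(** Equality holds almost everywhere; the set where the two densities differ is open, and a nonempty
    open set has positive Lebesgue measure. *)
Lemma density_unique g : has_density P g -> f = g.
Proof.
have [cf f0 PE] := Pf; move=> [cg g0 PE']; apply/funext => x; apply: contrapT => fgx.
have mf A : measurable_fun A (fun x => (f x)%:E) by exact: measurable_EFin_continuous.
have fi : leb.-integrable setT (fun x => (f x)%:E).
  apply/integrableP; split => //.
  under eq_integral do rewrite gee0_abs ?lee_fin ?(ltW (f0 _)) //.
  by rewrite -PE // (le_lt_trans (probability_le1 P _)) // ltry.
have := @integral_ae_eq _ _ _ leb setT measurableT (fun x => (g x)%:E)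
  (fun x => (f x)%:E) fi (measurable_EFin_continuous cg) _.
case; first by move=> E _ mE; rewrite -PE // PE'.
move=> N [mN N0 sub].
have oU : open [set x | f x != g x].
  rewrite (_ : [set x | _] = (f - g) @^-1` [set~ 0]); last first.
    by apply/seteqP; split => y /=; rewrite -subr_eq0 => /eqP.
  apply: open_comp; last by rewrite openC; exact: closed_eq.
  by move=> y _; apply: continuousB; [exact: cf|exact: cg].
have : (0 < leb [set x | f x != g x])%E.
  by apply: leb_open_gt0 => //; exists x; apply/eqP.
rewrite ltNge => /negP; apply; rewrite -N0; apply: le_measure; rewrite ?inE //.
  exact: measurable_open_rV.
by move=> y /= fgy; apply: sub => /= /(_ I)[] /eqP; rewrite (negbTE fgy).
Qed.

Import HBNNSimple.

(** The left integral is a supremum over simple functions below [g], and on each level set of such a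
    function the density formula applies. *)
Lemma integral_density_le (g : 'rV[R]_n -> \bar R) : measurable_fun setT g ->
  (forall x, 0 <= g x)%E -> (\int[P]_x g x <= \int[leb]_x (g x * (f x)%:E))%E.
Proof.
have [cf f0 PE] := Pf; move=> mg g0; rewrite ge0_integralTE //.
have mf A : measurable_fun A (fun x => (f x)%:E) by exact: measurable_EFin_continuous.
apply: ge_ereal_sup => _ [h /= hg <-].
rewrite sintegralE.
apply: (@le_trans _ _ (\int[leb]_x ((h x)%:E * (f x)%:E))%E); last first.
  apply: ge0_le_integral => // [x _|||x _].
  - by rewrite mule_ge0 // lee_fin // ltW.
  - by apply: emeasurable_funM => //; exact/measurable_EFinP.
  - exact: emeasurable_funM.
  - by rewrite lee_wpmul2r // lee_fin ltW.
under [leRHS]eq_integral.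
  move=> x _; rewrite fimfunE -fsumEFin // ge0_mule_fsuml; last first.
    by move=> r; rewrite EFinM nnfun_muleindic_ge0.
  over.
rewrite ge0_integral_fsum //; last 2 first.
- move=> r; apply: emeasurable_funM => //; apply/measurable_EFinP.
  by apply: measurable_funM => //; exact: measurable_indic.
- by move=> r x _; rewrite EFinM mule_ge0 ?nnfun_muleindic_ge0 // lee_fin ltW.
rewrite le_eqVlt; apply/orP; left; apply/eqP; apply: eq_fsbigr => r; rewrite inE => -[z _ hz].
transitivity (r%:E * \int[leb]_(x in h @^-1` [set r]) (f x)%:E)%E.
  by congr (_ * _)%E; exact: PE.
transitivity (\int[leb]_x (r%:E * ((\1_(h @^-1` [set r]) x)%:E * (f x)%:E)))%E; last first.
  by apply: eq_integral => x _ /=; rewrite muleA.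
rewrite ge0_integralZl //; last 3 first.
- by apply: emeasurable_funM => //; apply/measurable_EFinP; exact: measurable_indic.
- by move=> x _; apply: mule_ge0; rewrite lee_fin; [rewrite indicE|exact: ltW].
- by rewrite lee_fin -hz.
rewrite [in LHS]integral_mkcond.
congr (_ * _)%E; apply: eq_integral => x _; rewrite patchE indicE.
by case: ifP => _; rewrite ?mul1e ?mul0e.
Qed.

End one_density.

Lemma density_compare P f Q g k A : has_density P f -> has_density Q g ->
  measurable A -> 0 <= k -> (forall x, A x -> k * g x <= f x) -> (k%:E * Q A <= P A)%E.
Proof.
move=> [cf f0 PE] [cg g0 QE] mA k0 H; rewrite PE // QE // -ge0_integralZl //; last 2 first.
- exact: measurable_EFin_continuous cg.
- by move=> x _; rewrite lee_fin ltW.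
apply: ge0_le_integral => // [x _||]; first by rewrite -EFinM lee_fin mulr_ge0 // ltW.
- by apply: emeasurable_funM => //; exact: measurable_EFin_continuous cg.
- exact: measurable_EFin_continuous cf.
Qed.

Lemma leb_change_of_variables (k : R) a (D : set 'rV[R]_n) (f : 'rV[R]_n -> \bar R) :
  0 < k -> measurable D -> measurable_fun setT f -> (forall x, 0 <= f x)%E ->
  (\int[leb]_(x in D) f x =
   (k ^+ n)%:E * \int[leb]_(x in (fun x => (k *: x + a)%R) @^-1` D) f (k *: x + a)%R)%E.
Proof.
move=> k0 mD mf f0; have kn : 0 <= k ^+ n by rewrite exprn_ge0 // ltW.
rewrite -(ge0_integral_image_measure leb (measurable_affine_rV k a) mD) //.
rewrite -[(k ^+ n)%:E]/((NngNum kn)%:num%:E) -ge0_integral_mscale //; last first.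
  exact: measurable_funS mf.
apply: eq_measure_integral => A mA _; exact: leb_affine.
Qed.

End densities.

(** * Gaussian measures *)

Section gaussians.
Context {R : realType} {n : nat}.
Implicit Types (N B : probability 'rV[R]_n R) (m u v x : 'rV[R]_n) (A S : 'M[R]_n).

Lemma continuous_fctM (f g : 'rV[R]_n -> R) : continuous f -> continuous g ->
  continuous (fun x => f x * g x).
Proof. by move=> cf cg x; apply: continuousM; [exact: cf|exact: cg]. Qed.

Lemma continuous_fctN (f : 'rV[R]_n -> R) : continuous f -> continuous (fun x => - f x).
Proof. by move=> cf x; apply: continuousN; exact: cf. Qed.

Lemma qformZ A (k : R) u : qform A (k *: u) = k ^+ 2 * qform A u.
Proof.
by rewrite /qform linearZ /= -scalemxAr -!scalemxAl !mxE mulrA expr2.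
Qed.

Lemma qform_line A u v (k : R) : qform A (k *: v + u) = qform A u +
  k * ((u *m A *m v^T) 0 0 + (v *m A *m u^T) 0 0) + k ^+ 2 * qform A v.
Proof.
rewrite /qform linearD linearZ /= mulmxDr !mulmxDl -!scalemxAr -!scalemxAl.
move: (u *m A *m u^T) (u *m A *m v^T) (v *m A *m u^T) (v *m A *m v^T) => a b c d.
by rewrite !mxE; ring.
Qed.

Lemma posdef_qform_ge0 A u : posdef A -> 0 <= qform A u.
Proof.
move=> [_ HA]; have [->|/HA/ltW//] := eqVneq u 0.
by rewrite qform0.
Qed.

Lemma continuous_qform A m : continuous (fun x => qform A (x - m)).
Proof.
have cc i : continuous (fun x : 'rV[R]_n => x 0 i - m 0 i).
  by move=> x; apply: continuousB; [exact: coord_continuous|exact: cst_continuous].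
rewrite (_ : (fun _ => _) = fun x => \sum_i \sum_j A i j * (x 0 i - m 0 i) * (x 0 j - m 0 j)); last first.
  apply/funext => x; rewrite qformE; apply: eq_bigr => i _; apply: eq_bigr => j _.
  by rewrite !mxE.
apply: continuous_big => [|i _]; first exact: add_continuous.
apply: continuous_big => [|j _]; first exact: add_continuous.
apply: (continuous_fctM (f := fun x => A i j * (x 0 i - m 0 i))) => //.
by apply: continuous_fctM => // x; exact: cst_continuous.
Qed.

Lemma continuous_dotp_sub m : continuous (fun x => dotp (x - m) (x - m)).
Proof.
rewrite (_ : (fun _ => _) = fun x => qform 1%:M (x - m)); first exact: continuous_qform.
by apply/funext => x; rewrite /qform mulmx1 mulmx_dotp.
Qed.

Definition gauss_exponent S m x := - (2^-1 * qform (invmx S) (x - m)).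

Lemma continuous_gauss_exponent S m : continuous (gauss_exponent S m).
Proof.
apply: continuous_fctN; apply: continuous_fctM; last exact: continuous_qform.
by move=> x; exact: cst_continuous.
Qed.

Lemma gaussian_density N m S : gaussian N m S ->
  exists c, has_density N (fun x => expR (gauss_exponent S m x + c)).
Proof.
move=> [_ H]; apply: log_density_has_density H; exact: continuous_gauss_exponent.
Qed.

Lemma measurable_qform_gt A m s : measurable [set x | s < qform A (x - m)].
Proof.
have := continuous_measurable_rV (@continuous_qform A m).
move=> /(_ measurableT _ (measurable_itv `]s, +oo[%R)); rewrite setTI preimage_itvoy.
by congr (measurable _); apply/funext => x.
Qed.

(** Cauchy-Schwarz for the inner product of [invmx S], between [v] and the [i]-th row of [S], gives
    [v_i^2 <= S_ii * qform (invmx S) v]; summing over [i] produces the trace. *)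
Lemma dotp_le_qform S v : posdef S -> dotp v v <= (\sum_i S i i) * qform (invmx S) v.
Proof.
move=> pS; have [sS HS] := pS; have uS := posdef_unitmx pS.
rewrite /dotp mulr_suml; apply: ler_sum => i _.
pose e : 'rV[R]_n := basis i.
have e0 : e != 0.
  by apply/eqP => /rowP/(_ i); rewrite !mxE !eqxx => /eqP; rewrite oner_eq0.
have qe : qform S e = S i i by rewrite /qform -rowE mxE (bigD1 i) //= big1 ?addr0 ?mxE ?eqxx ?mulr1 // => j ji; rewrite !mxE (negbTE ji) mulr0.
have Sii : 0 < S i i by rewrite -qe; exact: HS.
(* This [t] minimises the form along the line [v - t (e S)]. *)
pose t := v 0 i / S i i.
have E1 : (v *m invmx S *m (e *m S)^T) 0 0 = v 0 i.
  rewrite trmx_mul sS mulmxA mulmxKV // mulmx_dotp /dotp (bigD1 i) //= big1 ?addr0 ?mxE ?eqxx ?mulr1 //.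
  by move=> j ji; rewrite !mxE (negbTE ji) mulr0.
have E2 : ((e *m S) *m invmx S *m v^T) 0 0 = v 0 i.
  rewrite mulmxK // mulmx_dotp /dotp (bigD1 i) //= big1 ?addr0 ?mxE ?eqxx ?mul1r //.
  by move=> j ji; rewrite !mxE (negbTE ji) mul0r.
have E3 : qform (invmx S) (e *m S) = S i i.
  by rewrite -qe /qform mulmxK // trmx_mul sS mulmxA.
have : 0 <= qform (invmx S) (- t *: (e *m S) + v).
  by apply: posdef_qform_ge0; exact: posdef_invmx.
rewrite qform_line E1 E2 E3 => /(mulr_ge0 (ltW Sii)) H.
rewrite -subr_ge0; move: H; congr (0 <= _).
by rewrite /t; field; rewrite gt_eqF.
Qed.

Section scaling.
Variables (N : probability 'rV[R]_n R) (m : 'rV[R]_n) (S : 'M[R]_n) (c : R).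
Hypotheses (pS : posdef S)
  (dN : has_density N (fun x => expR (gauss_exponent S m x + c))).

Let q x := qform (invmx S) (x - m).
Let q_ge0 x : 0 <= q x.
Proof. by apply: posdef_qform_ge0; exact: posdef_invmx. Qed.

Let q_scale x : q (2 *: x + - m) = 4 * q x.
Proof.
rewrite /q (_ : 2 *: x + - m - m = 2 *: (x - m)); last first.
  by apply/rowP => i; rewrite !mxE; ring.
by rewrite qformZ; congr (_ * _); ring.
Qed.

Let measurable_wide D : measurable_fun D (fun x => (expR (- (8^-1 * q x) + c))%:E).
Proof.
apply: measurable_EFin_continuous; apply: continuous_expR_comp.
apply: continuous_fctN; apply: continuous_fctM; last exact: continuous_qform.
by move=> x; exact: cst_continuous.
Qed.

(** The dilation [x -> 2 x - m] turns [q / 8] into [q / 2], so the integral is the Jacobian [2 ^ n]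
    times the total mass of [N]. *)
Lemma integral_wide_gauss :
  (\int[leb R n]_x (expR (- (8^-1 * q x) + c))%:E = (2 ^+ n)%:E)%E.
Proof.
have [cf f0 NE] := dN.
have f1 x : (0 <= (expR (- (8^-1 * q x) + c))%:E)%E by rewrite lee_fin expR_ge0.
rewrite (leb_change_of_variables (- m) (ltr0Sn R 1) measurableT (@measurable_wide setT) f1).
rewrite preimage_setT; under eq_integral do rewrite q_scale.
have I1 : (\int[leb R n]_x (expR (- (8^-1 * (4 * q x)) + c))%:E = 1)%E.
  rewrite -(probability_setT N) (NE _ measurableT); apply: eq_integral => x _.
  by congr (expR _)%:E; rewrite /gauss_exponent -/(q x); lra.
by rewrite I1 mule1.
Qed.

(** Split [q / 2] as [3 q / 8 + q / 8]: the first part exceeds [3 s / 8] on the tail, the second is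
    the wide Gaussian. The bound is uniform in [S]. *)
Lemma gauss_tail s :
  (N [set x | (s < q x)%R] <= (2 ^+ n * expR (- (3 / 8 * s)))%:E)%E.
Proof.
have [cf f0 NE] := dN.
have mA : measurable [set x | s < q x] by exact: measurable_qform_gt.
have w0 x : (0 <= (expR (- (8^-1 * q x) + c))%:E)%E by rewrite lee_fin expR_ge0.
have e0 : (0 <= (expR (- (3 / 8 * s)))%:E)%E by rewrite lee_fin expR_ge0.
rewrite mulrC EFinM -integral_wide_gauss.
rewrite -(@ge0_integralZl _ _ _ (leb R n) setT measurableT _ (@measurable_wide setT) _ (fun x _ => w0 x) e0).
rewrite (NE _ mA).
apply: (@le_trans _ _ (\int[leb R n]_(x in [set x | (s < q x)%R])
   ((expR (- (3 / 8 * s)))%:E * (expR (- (8^-1 * q x) + c))%:E))%E).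
  apply: (@ge0_le_integral _ _ _ _ _ mA) => [x _|||x /= sx].
  - by rewrite lee_fin expR_ge0.
  - exact: measurable_EFin_continuous.
  - by apply: emeasurable_funM.
  - rewrite -EFinM lee_fin -expRD ler_expR /gauss_exponent -/(q x); lra.
apply: ge0_subset_integral => //; by apply: emeasurable_funM.
Qed.

(** [|x - m|^2] is at most a multiple of [q], and [q * exp (- 3 q / 8)] is bounded, so the wide
    Gaussian dominates. The strict comparison of second moments relies on this finiteness. *)
Lemma gauss_second_moment : (\int[N]_x (dotp (x - m) (x - m))%:E < +oo)%E.
Proof.
have [cf f0 NE] := dN; pose K := \sum_i S i i.
have cd := @continuous_dotp_sub m.
have K0 x : 0 <= K * q x.
  by apply: le_trans (dotp_le_qform (x - m) pS); exact: dotp_ge0.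
apply: le_lt_trans (integral_density_le dN _ _) _.
- exact: measurable_EFin_continuous.
- by move=> x; rewrite lee_fin dotp_ge0.
have KK0 : 0 <= `|K| * (8 / 3) by rewrite mulr_ge0 // divr_ge0.
apply: (@le_lt_trans _ _ (\int[leb R n]_x ((`|K| * (8 / 3))%:E * (expR (- (8^-1 * q x) + c))%:E))%E); last first.
  have w0 x : (0 <= (expR (- (8^-1 * q x) + c))%:E)%E by rewrite lee_fin expR_ge0.
  have k0 : (0 <= (`|K| * (8 / 3))%:E)%E by rewrite lee_fin.
  rewrite (@ge0_integralZl _ _ _ (leb R n) setT measurableT _ (@measurable_wide setT) _ (fun x _ => w0 x) k0).
  by rewrite integral_wide_gauss -EFinM ltry.
apply: (@ge0_le_integral _ _ _ _ _ measurableT) => [x _|||x _].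
- by rewrite -EFinM lee_fin mulr_ge0 ?dotp_ge0 ?expR_ge0.
- by apply: emeasurable_funM; exact: measurable_EFin_continuous.
- by apply: emeasurable_funM.
rewrite -!EFinM lee_fin.
have e1 : gauss_exponent S m x + c = - (3 / 8 * q x) + (- (8^-1 * q x) + c).
  by rewrite /gauss_exponent -/(q x); field.
rewrite e1 expRD mulrA ler_wpM2r ?expR_ge0 //.
have h1 : dotp (x - m) (x - m) <= `|K| * q x.
  apply: le_trans (dotp_le_qform (x - m) pS) _.
  by rewrite -/K -/(q x) ler_wpM2r // ler_norm.
(* From [1 + y <= exp y] at [y = 3 q / 8]. *)
have h2 : q x * expR (- (3 / 8 * q x)) <= 8 / 3.
  rewrite expRN ler_pdivrMr ?expR_gt0 //.
  have := expR_ge1Dx (3 / 8 * q x); lra.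
apply: le_trans (ler_wpM2r (expR_ge0 _) h1) _.
by rewrite -(mulrA `|K| (q x)) ler_wpM2l.
Qed.

(* Scaling by 2 maps the sublevel set of [q] at [s] onto the one at [4 * s]; so the
   annulus between them is at least as large as the inner set. *)
Lemma gauss_spread s : (0 < n)%N -> 0 <= s ->
  ((expR (- (2 * s)) / 2)%:E <= N [set x | (s < q x)%R])%E.
Proof.
move=> n0 s0; have [cf f0 NE] := dN.
pose In := [set x | q x <= s]; pose Out := [set x | s < q x].
pose Ring := [set x | s < q x <= 4 * s].
have mgt t : measurable [set x | t < q x] by exact: measurable_qform_gt.
have mle t : measurable [set x | q x <= t].
  rewrite (_ : [set x | _] = ~` [set x | t < q x]); first exact: measurableC.
  by apply/funext => x /=; rewrite /setC /= leNgt; apply/propext; split => /negP.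
have mRing : measurable Ring.
  rewrite (_ : Ring = [set x | s < q x] `&` [set x | q x <= 4 * s]); first exact: measurableI.
  by apply/funext => x /=; apply/propext; split => /andP.
have V4 : leb R n [set x | q x <= 4 * s] = ((2 ^+ n)%:E * leb R n In)%E.
  rewrite (@leb_affine _ _ 2 (- m)) //; congr (_ * leb R n _)%E.
  by apply/funext => x /=; rewrite q_scale ler_pM2l.
have VU : leb R n [set x | q x <= 4 * s] = (leb R n In + leb R n Ring)%E.
  have disj : In `&` Ring = set0.
    by apply/seteqP; split => x //= -[]; rewrite /In /Ring /= leNgt => /negP H /andP[].
  have -> : (leb R n In + leb R n Ring = leb R n (In `|` Ring))%E.
    by rewrite measureU //; exact: mle.
  congr (leb R n _); apply/funext => x; apply/propext; rewrite /In /Ring /=; split.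
    by move=> ->; rewrite andbT; case: (leP (q x) s); [left|right].
  case=> [qs|/andP[]//]; apply: le_trans qs _; have := s0; lra.
have low : ((expR (- (2^-1 * s) + c))%:E * leb R n In <= N In)%E.
  apply: (density_ge dN (mle s)) => [x /= qs|]; last exact: expR_ge0.
  by rewrite ler_expR lerD2r lerN2 ler_pM2l.
have up : (N In <= (expR c)%:E * leb R n In)%E.
  apply: (density_le dN (mle s)) => [x _|]; last exact: expR_ge0.
  by rewrite ler_expR gerDr oppr_le0 mulr_ge0 // q_ge0.
have ring : ((expR (- (2 * s) + c))%:E * leb R n Ring <= N Ring)%E.
  apply: (density_ge dN mRing) => [x /= /andP[_ qs]|]; last exact: expR_ge0.
  rewrite ler_expR lerD2r lerN2; move: qs; rewrite -/(q x); lra.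
have finIn : leb R n In \is a fin_num.
  rewrite ge0_fin_numE //; apply: contraTT low; rewrite -leNgt leye_eq => /eqP ->.
  rewrite mulry gtr0_sg ?expR_gt0 // mul1e -ltNge.
  by apply: (le_lt_trans (probability_le1 N (mle s))); rewrite ltry.
(* [Ring] has [2 ^ n - 1] times the volume of [In], and [0 < n] makes this factor at least 1. *)
have RI : (leb R n In <= leb R n Ring)%E.
  have r0 : (0 <= leb R n In)%E by [].
  have p2 : 2 <= 2 ^+ n :> R by rewrite -[leLHS]expr1 ler_eXn2l // ltr1n.
  have := V4; rewrite VU; move: finIn r0; case: (leb R n In) => // r _.
  rewrite lee_fin => r0.
  case: (leb R n Ring) => [w||]; rewrite -?EFinM -?EFinD ?leey //= => -[E].
  rewrite lee_fin; have := ler_wpM2r r0 p2; lra.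
have RO : (N Ring <= N Out)%E.
  by apply: le_measure; [rewrite inE|rewrite inE; exact: mgt|move=> x /= /andP[]].
have InOut : N In = (1 - N Out)%E.
  rewrite -(probability_setC _ (mgt s)); congr (N _); apply/funext => x; rewrite /In /Out /setC /= leNgt.
  by apply/propext; split => /negP.
have e0 (t : R) : (0 <= (expR t)%:E)%E by rewrite lee_fin expR_ge0.
(* The density is at most [exp c] on [In] and at least [exp (c - 2 s)] on [Ring], where
   [q <= 4 s]. *)
have chain : ((expR (- (2 * s)))%:E * N In <= N Out)%E.
  have h1 := lee_wpmul2l (e0 (- (2 * s))) up.
  have h2 := lee_wpmul2l (e0 (- (2 * s) + c)) RI.
  rewrite muleA -EFinM -expRD in h1.
  exact: le_trans h1 (le_trans h2 (le_trans ring RO)).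
have NOfin : N Out \is a fin_num by apply: fin_num_measure; exact: mgt.
(* With [y = exp (- 2 s)] and [r] the outer mass, [y (1 - r) <= r] and [y <= 1] give
   [r >= y / 2]. *)
move: chain; rewrite InOut -/Out; case: (N Out) NOfin => // r _.
rewrite -EFinB -EFinM !lee_fin.
have : expR (- (2 * s)) <= 1 by rewrite expR_le1; lra.
have := expR_gt0 (- (2 * s)); move: (expR _) => y y0 y1 H.
nra.
Qed.

End scaling.
End gaussians.

(** * Laplace approximation *)

Section nonmeasurable_integrands.
Context d (T : measurableType d) (R : realType).
Local Open Scope ereal_scope.
Import HBNNSimple.

(** The integral of a nonnegative function is a supremum over the simple functions below it, and
    that family grows with the function. *)
Lemma le_integral_nonmeasurable (mu : {measure set T -> \bar R}) (f g : T -> \bar R) :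
  (forall x, 0 <= f x) -> (forall x, f x <= g x) ->
  \int[mu]_x f x <= \int[mu]_x g x.
Proof.
move=> f0 fg; rewrite !ge0_integralTE => [||//]; last first.
  by move=> x; exact: le_trans (f0 x) (fg x).
apply: le_ereal_sup => _ [h /= hf <-]; exists h => // x.
exact: le_trans (hf x) (fg x).
Qed.

(* For a nonmeasurable [f] the integral is a lower integral; it is attained by
   a measurable minorant, for which strictness is standard. *)
Lemma lt_integral_nonmeasurable (P : probability T R) (f g : T -> R) (Z : set T) :
  measurable_fun setT g -> (forall x, 0 <= f x <= g x)%R ->
  measurable Z -> P Z = 0 -> (forall x, ~ Z x -> (f x < g x)%R) ->
  \int[P]_x (g x)%:E < +oo -> \int[P]_x (f x)%:E < \int[P]_x (g x)%:E.
Proof.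
move=> mg fg mZ Z0 flt gfin.
have f0 x : 0 <= (f x)%:E by rewrite lee_fin; case/andP: (fg x).
have g0 x : 0 <= (g x)%:E by rewrite lee_fin; case/andP: (fg x) => /le_trans; apply.
have Ifg : \int[P]_x (f x)%:E <= \int[P]_x (g x)%:E.
  by apply: le_integral_nonmeasurable => // x; rewrite lee_fin; case/andP: (fg x).
have Ifin : \int[P]_x (f x)%:E \is a fin_num.
  by rewrite ge0_fin_numE ?(le_lt_trans Ifg) // integral_ge0.
rewrite lt_neqAle Ifg andbT; apply/eqP => Ieq.
have H k : exists h : {nnsfun T >-> R}, (forall x, (h x)%:E <= (f x)%:E) /\
    \int[P]_x (f x)%:E - k.+1%:R^-1%:E < sintegral P h.
  have e0 : (0 < k.+1%:R^-1 :> R)%R by rewrite invr_gt0.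
  move: Ifin; rewrite ge0_integralTE // => Ifin.
  have [_ [h /= hf <-] Hh] := ub_ereal_sup_adherent e0 Ifin.
  by exists h.
pose h k := sval (cid (H k)).
have hf k x : (h k x)%:E <= (f x)%:E by have [] := svalP (cid (H k)).
have hI k : \int[P]_x (f x)%:E - k.+1%:R^-1%:E < sintegral P (h k).
  by have [] := svalP (cid (H k)).
(* The supremum of simple minorants whose integrals approach that of [f] is a measurable minorant
   with the same integral. *)
pose F x := esups (fun k => (h k x)%:E) 0%N.
have mF : measurable_fun setT F.
  apply: (@measurable_fun_esups _ _ _ setT (fun k x => (h k x)%:E)) => k.
  exact/measurable_EFinP.
have hF k x : (h k x)%:E <= F x by apply: ereal_sup_ubound; exists k.
have Ff x : F x <= (f x)%:E by apply: ge_ereal_sup => _ [k _ <-].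
have F0 x : 0 <= F x by apply: le_trans (hF 0%N x); rewrite lee_fin.
have IF : \int[P]_x (f x)%:E <= \int[P]_x F x.
  apply/lee_addgt0Pr => e e0; pose k := Num.truncn e^-1.
  have ke : (k.+1%:R^-1 < e)%R by rewrite invf_plt ?posrE // truncnS_gt.
  apply: (@le_trans _ _ (sintegral P (h k) + k.+1%:R^-1%:E)).
    by rewrite -leeBlDr //; exact: ltW.
  apply: leeD; last by rewrite lee_fin ltW.
  rewrite (ge0_integralTE _ F0); apply: ereal_sup_ubound; by exists (h k).
have IFg : \int[P]_x F x = \int[P]_x (g x)%:E.
  apply/le_anti/andP; split; last by rewrite -Ieq.
  apply: le_integral_nonmeasurable => // x; apply: le_trans (Ff x) _.
  by rewrite lee_fin; case/andP: (fg x).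
have iF : P.-integrable setT F.
  apply/integrableP; split => //; under eq_integral do rewrite gee0_abs //.
  by rewrite IFg.
have ig : P.-integrable setT (EFin \o g).
  apply/integrableP; split; first exact/measurable_EFinP.
  rewrite (eq_integral (fun x => (g x)%:E)) // => x _.
  exact: (gee0_abs (g0 x)).
have gF0 x : 0 <= (g x)%:E - F x.
  rewrite sube_ge0; last by rewrite orbC.
  by apply: le_trans (Ff x) _; rewrite lee_fin; case/andP: (fg x).
have Id : \int[P]_x ((g x)%:E - F x) = 0.
  rewrite (@integralB _ _ _ P setT measurableT (EFin \o g) F) // IFg subee //.
  by rewrite -Ieq.
have mgF : measurable_fun setT (fun x => (g x)%:E - F x).
  by apply: emeasurable_funB => //; exact/measurable_EFinP.
have := (@ae_eq_integral_abs _ _ _ P setT measurableT _ mgF).1.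
under eq_integral do rewrite gee0_abs //.
move=> /(_ Id)[M [mM M0 sub]].
(* [g = F] outside the null set [M], while [F <= f < g] outside [Z]; so two null sets would cover a
   space of mass 1. *)
have : P (Z `|` M) = 0.
  apply/eqP; rewrite eq_le measure_ge0 andbT.
  have Zle : P Z <= 0 by rewrite Z0.
  have Mle : P M <= 0 by rewrite M0.
  apply: le_trans (@measureU2 _ _ _ P _ _ mZ mM) _.
  rewrite -(adde0 0); exact: leeD Zle Mle.
rewrite (_ : Z `|` M = setT) ?probability_setT; first by move/eqP; rewrite onee_eq0.
apply/seteqP; split => // x _; apply: contrapT => /not_orP[nZ nM].
apply: nM; apply: sub => /= /(_ I) E.
have : F x < (g x)%:E by apply: le_lt_trans (Ff x) _; rewrite lte_fin; exact: flt.
by rewrite -sube_gt0 E ltxx.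
Qed.

End nonmeasurable_integrands.

Section laplace_approximation.
Context {R : realType} {n : nat}.
Implicit Types (N B P : probability 'rV[R]_n R) (m th u v x : 'rV[R]_n) (S : 'M[R]_n).

(** Geometric bounds on [Exp] enter the law here: [E] is measurable even if the set of velocities
    sent into [A] is not known to be. *)
Lemma laplace_law_le (G : 'rV[R]_n -> 'M[R]_n) th N A E : measurable E ->
  (forall v, A (Exp G th v) -> E v) -> (laplace_law G th N A <= N E)%E.
Proof.
move=> mE AE.
have -> : N E = (\int[N]_v (\1_E v)%:E)%E by rewrite integral_indic // setIT.
apply: le_integral_nonmeasurable => v; rewrite lee_fin !indicE //.
by case: (pselect (A (Exp G th v))) => [/[dup] /AE Ev Av|nA];
  rewrite ?(mem_set Ev) ?(memNset nA) ?lexx ?ler_b1 //= ?ler0n // lern1 leq_b1.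
Qed.

(** A change of variables gives equality up to the ratio of normalising constants; the whole space
    shows that this ratio is 1. *)
Lemma gauss_translate N B m S A : gaussian N 0 S -> gaussian B m S -> measurable A ->
  B A = N ((fun x => x + m) @^-1` A).
Proof.
move=> gN gB; have [c dN] := gaussian_density gN; have [c' dB] := gaussian_density gB.
have [_ _ NE] := dN; have [cB _ BE] := dB.
have H D : measurable D -> B D = ((expR (c' - c))%:E * N ((fun x => (x + m)%R) @^-1` D))%E.
  move=> mD; have mD' : measurable ((fun x => x + m) @^-1` D).
    rewrite (_ : (fun x => x + m) = (fun x => 1 *: x + m)); last by apply/funext => x; rewrite scale1r.
    by rewrite -[X in measurable X]setTI; exact: measurable_affine_rV.
  rewrite BE // NE //.
  have b0 x : (0 <= (expR (gauss_exponent S m x + c'))%:E)%E by rewrite lee_fin expR_ge0.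
  rewrite (leb_change_of_variables m ltr01 mD (measurable_EFin_continuous cB) b0).
  rewrite expr1n mul1e (_ : (fun x => (1 *: x + m)%R) = (fun x => x + m)); last first.
    by apply/funext => x; rewrite scale1r.
  have n0 x : (0 <= (expR (gauss_exponent S 0 x + c))%:E)%E by rewrite lee_fin expR_ge0.
  have e0 : (0 <= (expR (c' - c))%:E)%E by rewrite lee_fin expR_ge0.
  have [cN _ _] := dN.
  rewrite -(@ge0_integralZl _ _ _ (leb R n) _ mD' _ (measurable_EFin_continuous cN) _ (fun x _ => n0 x) e0).
  apply: eq_integral => x _; rewrite -EFinM -expRD; congr (expR _)%:E.
  by rewrite /gauss_exponent scale1r addrK subr0; ring.
move=> mA; rewrite H //.
have := H setT measurableT; rewrite preimage_setT !probability_setT mule1 => -[<-].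
by rewrite mul1e.
Qed.

(** Quadratic increments cover both a Gaussian log-density and its affine partial derivatives. *)
Lemma is_derive_increment (f : 'rV[R]_n -> R) x u (a b : R) :
  (forall h : R, f (h *: u + x) = f x + h * a + h ^+ 2 * b) -> is_derive x u f a.
Proof.
move=> H.
have di := is_derive_id (0 : R) (1 : R).
have dc (t : R) := is_derive_cst t (0 : R) (1 : R).
have [] := is_deriveD (is_deriveD (dc (f x)) (is_deriveM di (dc a)))
  (is_deriveM (is_deriveM di di) (dc b)).
rewrite /derivable /derive.
have -> : (fun h : R => h^-1 *: ((cst (f x) + id * cst a + id * id * cst b) (h *: 1 + 0) -
    (cst (f x) + id * cst a + id * id * cst b) 0)) =
    (fun h : R => h^-1 *: (f (h *: u + x) - f x)).
  apply/funext => h; congr (_ *: _); rewrite addr0 (_ : h *: (1 : R) = h); last exact: mulr1.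
  by rewrite H -[LHS]/(f x + h * a + h * h * b - (f x + 0 * a + 0 * 0 * b)); ring.
move=> c1 c2; split => //; rewrite /derive c2 -[LHS]/(0 + (0 * 0 + a * 1) + ((0 * 0) * 0 + b * (0 * 1 + 0 * 1))).
ring.
Qed.

(** Uniqueness of continuous densities makes [ell] the Gaussian exponent up to a constant, whose
    maximiser and Hessian are explicit. *)
Lemma gaussian_log_posterior P ell m S th : log_posterior P ell th -> gaussian P m S ->
  th = m /\ laplace_cov ell th = S.
Proof.
move=> [Hell ldP Hmax] gP; have [pS _] := gP.
have cell : continuous ell.
  by move: Hell => /CkS /CkS /CkS.
have [c d1] := log_density_has_density cell ldP; have [c' d2] := gaussian_density gP.
have Eell x : ell x = - (2^-1 * qform (invmx S) (x - m)) + (c' - c).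
  have := congr1 (fun f : 'rV[R]_n -> R => ln (f x)) (density_unique d1 d2).
  by rewrite /= !expRK /gauss_exponent => E; lra.
have pI := posdef_invmx pS; have [sI HI] := pI.
have thm : th = m.
  apply/eqP; rewrite -subr_eq0; apply: contraT => /HI.
  have := Hmax m; rewrite !Eell subrr qform0; lra.
split => //; rewrite /laplace_cov -[RHS]invmxK; congr invmx.
pose A := invmx S.
have dotA i x : (x *m A *m (basis i : 'rV[R]_n)^T) 0 0 = (x *m A) 0 i.
  rewrite mulmx_dotp /dotp (bigD1 i) //= big1 ?addr0 ?[basis i 0 i]mxE ?eqxx ?mulr1 //.
  by move=> j ji; rewrite [basis i 0 j]mxE (negbTE ji) mulr0.
have sym i x : ((basis i : 'rV[R]_n) *m A *m x^T) 0 0 = (x *m A) 0 i.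
  rewrite -dotA; transitivity (((basis i : 'rV[R]_n) *m A *m x^T)^T 0 0); first by rewrite [RHS]mxE.
  by rewrite !trmx_mul trmxK sI mulmxA.
have D1 j : 'D_(basis j) ell = fun x => - ((x - m) *m A) 0 j.
  apply/funext => x; apply: derive_val.
  apply: (@is_derive_increment _ _ _ _ (- (2^-1 * qform A (basis j)))) => h.
  by rewrite !Eell -addrA qform_line dotA sym; field.
apply/matrixP => i j; rewrite !mxE D1.
have -> : 'D_(basis i) (fun x => - ((x - m) *m A) 0 j) th = - A i j.
  apply: derive_val; apply: (@is_derive_increment _ _ _ _ 0) => h.
  rewrite -(addrA (h *: _)) mulmxDl -scalemxAl -rowE.
  rewrite [X in - X = _]mxE [X in - (X + _)]mxE [row i A 0 j]mxE; ring.
by rewrite opprK.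
Qed.

End laplace_approximation.

Section probability_values.
Context d (T : measurableType d) (R : realType) (P : probability T R).
Implicit Types A B C : set T.

Definition prob A : R := fine (P A).

Lemma probE A : measurable A -> P A = (prob A)%:E.
Proof. by move=> mA; rewrite /prob fineK // fin_num_measure. Qed.

Lemma prob_cover A B C : measurable A -> measurable B -> measurable C ->
  A `<=` B `|` C -> prob A <= prob B + prob C.
Proof.
move=> mA mB mC ABC; rewrite -lee_fin EFinD -!probE //.
apply: (@le_trans _ _ (P (B `|` C))); last exact: measureU2.
by apply: le_measure => //; rewrite inE //; exact: measurableU.
Qed.

Lemma prob_disjointU A B : measurable A -> measurable B -> A `&` B = set0 ->
  prob (A `|` B) = prob A + prob B.
Proof.
move=> mA mB AB0; apply: EFin_inj; rewrite EFinD -!probE //; last exact: measurableU.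
exact: measureU.
Qed.

Lemma prob_le A B : measurable A -> measurable B -> A `<=` B -> prob A <= prob B.
Proof.
by move=> mA mB AB; rewrite -lee_fin -!probE //; apply: le_measure => //; rewrite inE.
Qed.

End probability_values.

(** * A uniform lower bound on the total variation errors *)

Section laplace_gap.
Context {R : realType} {n : nat}.
Implicit Types (N B P : probability 'rV[R]_n R) (th u v x : 'rV[R]_n) (S : 'M[R]_n).

Lemma exp_decay_small (a k e : R) : 0 <= a -> 0 < k -> 0 < e ->
  exists j : nat, a * expR (- (k * j%:R)) <= e.
Proof.
move=> a0 k0 e0; pose t := a / e / k; exists (Num.truncn t).+1.
have tj : t < (Num.truncn t).+1%:R by rewrite truncnS_gt.
rewrite expRN ler_pdivrMr ?expR_gt0 // -ler_pdivrMl //.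
apply: le_trans (expR_ge1Dx _); apply: ler_wpDl => //.
by move: tj; rewrite ltr_pdivrMr // => /ltW; rewrite [e^-1 * a]mulrC [k * _]mulrC.
Qed.

Lemma measurable_dotp_gt th s : measurable [set x | s < dotp (x - th) (x - th)].
Proof.
have := continuous_measurable_rV (@continuous_dotp_sub R n th).
move=> /(_ measurableT _ (measurable_itv `]s, +oo[%R)); rewrite setTI preimage_itvoy.
by congr (measurable _); apply/funext => x.
Qed.

Lemma measurable_qform_le (A : 'M[R]_n) th s : measurable [set x | qform A (x - th) <= s].
Proof.
rewrite (_ : [set x | _] = ~` [set x | s < qform A (x - th)]).
  by apply: measurableC; exact: measurable_qform_gt.
by apply/funext => x; rewrite /setC /= leNgt; apply/propext; split => /negP.
Qed.

Lemma laplace_law_transfer (G : 'rV[R]_n -> 'M[R]_n) th N P (A E : set 'rV[R]_n) (delta : R) :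
  measurable A -> measurable E -> (forall v, A (Exp G th v) -> E v) ->
  (`|laplace_law G th N A - P A| <= delta%:E)%E -> prob P A <= prob N E + delta.
Proof.
move=> mA mE AE; have := laplace_law_le N mE AE.
rewrite (probE _ mE) (probE _ mA); case: (laplace_law _ _ _ _) => [l||] //=.
rewrite !lee_fin => lE; rewrite ler_norml => /andP[+ _]; lra.
Qed.

Lemma log_posterior_grad P ell th : log_posterior P ell th ->
  Ck 2 ell /\ grad ell th = 0.
Proof.
by move=> [Hell _ Hmax]; split; [exact: CkS|apply: grad_max => //; do 2 apply: CkS].
Qed.

(* [p0] and [b0] are the values at [th] of the densities of [P] and [B]; as [P]
   is close to [B], which puts half of its mass where its density is at least
   [b0 * exp (- M / 2)], the maximum [p0] cannot be much smaller than [b0]. *)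
Lemma density_peak_ge P B th S (ell : 'rV[R]_n -> R) (cP cB M : R) :
  posdef S -> (forall x, ell x <= ell th) ->
  has_density P (fun x => expR (ell x + cP)) ->
  has_density B (fun x => expR (gauss_exponent S th x + cB)) ->
  4^-1 <= prob P [set x | qform (invmx S) (x - th) <= M] ->
  4^-1 * expR (cB - M / 2) <= expR (ell th + cP).
Proof.
move=> pS Hmax dP dB; set E := [set x | _] => PE.
have mE : measurable E by exact: measurable_qform_le.
have h1 : (P E <= (expR (ell th + cP))%:E * leb R n E)%E.
  apply: (density_le dP mE) => [x _|]; last exact: expR_ge0.
  by rewrite ler_expR lerD2r.
have h2 : ((expR (cB - M / 2))%:E * leb R n E <= 1)%E.
  apply: le_trans (probability_le1 B mE).
  apply: (density_ge dB mE) => [x /= qM|]; last exact: expR_ge0.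
  have {}qM : qform (invmx S) (x - th) <= M by exact: qM.
  rewrite ler_expR /gauss_exponent; lra.
have : (0 <= leb R n E)%E by [].
have b0 := expR_gt0 (cB - M / 2); have p0 := expR_gt0 (ell th + cP).
(* The volume of [E] is eliminated between [h1] and [h2]; an infinite volume contradicts [h2]. *)
move: h1 h2; rewrite (probE P mE); case: (leb R n E) => [w||] //=; last first.
  by rewrite !gt0_muley ?lte_fin // => _; rewrite leye_eq.
rewrite -!EFinM !lee_fin => h1 h2 w0.
have h3 := le_trans PE h1.
apply: (@le_trans _ _ (expR (ell th + cP) * w * expR (cB - M / 2))).
  by rewrite ler_wpM2r // ltW.
by rewrite -mulrA ler_piMr ?(ltW p0) // mulrC.
Qed.

(** [delta] depends only on [n] and [C], so the statement refutes both exactness for one Gaussian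
    target and convergence along a sequence. *)
Lemma laplace_gap (C : R) : (0 < n)%N -> exists2 delta : R, 0 < delta &
  forall P ell th N B, log_posterior P ell th ->
  gaussian N 0 (laplace_cov ell th) -> gaussian B th (laplace_cov ell th) ->
  (forall i j, `|laplace_cov ell th i j| <= C) ->
  (forall A, measurable A ->
    (`|laplace_law (grad_metric ell) th N A - P A| <= delta%:E)%E) ->
  (forall A, measurable A -> (`|P A - B A| <= delta%:E)%E) -> False.
Proof.
move=> n0.
have t0 : 0 <= 2 ^+ n :> R by rewrite exprn_ge0.
have [jM HM] := @exp_decay_small (2 ^+ n) (3 / 8) 2^-1 t0 ltac:(lra) ltac:(lra).
(* At most half of [B] lies beyond [q = M]. With [s = M + 8] the density of [B] beyond [q = s] is at
   most [exp (- 4)] times its value at [q = M], and [c] is the mass that [gauss_spread] guarantees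
   there. *)
pose M : R := jM%:R; pose s := M + 8; pose c := expR (- (2 * s)) / 2.
have M0 : 0 <= M by rewrite ler0n.
have s0 : 0 <= s by rewrite /s; lra.
have c0 : 0 < c by rewrite divr_gt0 // expR_gt0.
(* [K] exceeds the trace of the covariance, so squared distances are at most [K q]; [J] then leaves
   [B] a mass of at most [c / 4] beyond squared radius [J]. *)
pose K := n%:R * `|C| + 1.
have K0 : 0 < K by rewrite ltr_wpDl // mulr_ge0.
have k0 : 0 < 3 / 8 / K by rewrite divr_gt0 //; lra.
have [J HJ] := @exp_decay_small (2 ^+ n) (3 / 8 / K) (c / 4) t0 k0 ltac:(lra).
(* One [delta] is spent on [A] minus [W], and [2 * delta] on each of [J] shells. *)
pose L : R := 1 + 2 * J%:R.
have L0 : 0 < L by rewrite /L; have := ler0n R J; lra.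
pose delta := Num.min 4^-1 (c / 4 / L).
have c4 : 0 < c / 4 by apply: divr_gt0.
have d0 : 0 < delta by rewrite lt_min invr_gt0 ltr0n; apply: divr_gt0.
have d1 : delta <= 4^-1 by rewrite ge_min lexx.
have d2 : delta * L <= c / 4 by rewrite -ler_pdivlMr // ge_min lexx orbT.
exists delta => // P ell th N B lP gN gB HC Hlaw HPB.
have [Hell g0] := log_posterior_grad lP; have [Hell3 ldP Hmax] := lP.
set S := laplace_cov ell th in gN gB HC; have [pS _] := gB.
have cell : continuous ell by move: Hell => /CkS /CkS.
have [cP dP] := log_density_has_density cell ldP.
have [cB dB] := gaussian_density gB.
pose q x := qform (invmx S) (x - th).
have PB A : measurable A -> `|prob P A - prob B A| <= delta.
  by move=> mA; rewrite -lee_fin; have := HPB A mA; rewrite !probE.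
have BN A : measurable A -> prob B A = prob N ((fun x => x + th) @^-1` A).
  by move=> mA; rewrite /prob (gauss_translate gN gB mA).
have Btail t : prob B [set x | t < q x] <= 2 ^+ n * expR (- (3 / 8 * t)).
  have := gauss_tail dB t.
  by rewrite -/q probE ?lee_fin //; exact: measurable_qform_gt.
have Bspread : c <= prob B [set x | s < q x].
  have := gauss_spread pS dB n0 s0.
  by rewrite -/q probE ?lee_fin //; exact: measurable_qform_gt.
pose E := [set x | q x <= M].
have mE : measurable E by exact: measurable_qform_le.
have PE : 4^-1 <= prob P E.
  have := PB E mE; rewrite ler_norml => /andP[+ _].
  have : prob B setT <= prob B [set x | M < q x] + prob B E.
    apply: prob_cover => //; first exact: measurable_qform_gt.
    by move=> x _; case: (ltP M (q x)); [left|right].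
  rewrite /(prob B setT) probability_setT /=; have := Btail M; lra.
have peak := density_peak_ge pS Hmax dP dB PE.
pose W := [set x | 1 <= ell th - ell x].
have mW : measurable W.
  have := continuous_measurable_rV cell.
  move=> /(_ measurableT _ (measurable_itv `]-oo, (ell th - 1)]%R)); rewrite setTI.
  congr (measurable _); apply/funext => x; rewrite /W /= in_itv /=.
  by apply/propext; split; lra.
pose A := [set x | s < q x].
have mA : measurable A by exact: measurable_qform_gt.
have mAW : measurable (A `\` W) by exact: measurableD.
(* Off [W] the density of [P] is within a factor [exp (- 1)] of its peak, hence at least
   [exp 3 / 4 >= 2] times that of [B] on this set. So twice the [B]-mass is at most the [P]-mass,
   itself at most the [B]-mass plus [delta]. *)
have BAW : prob B (A `\` W) <= delta.
  have : 2 * prob B (A `\` W) <= prob P (A `\` W).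
    rewrite -lee_fin EFinM -!probE //; apply: (density_compare dP dB mAW) => // x [/= sx /negP].
    rewrite -ltNge => Wx.
    have e1 : 2 <= expR 1 :> R by have := expR_ge1Dx (1 : R); lra.
    have e3 : 8 <= expR 3 :> R.
      rewrite (_ : 3 = 1 + 1 + 1) ?expRD; last by ring.
      have := ler_pM (ler0n R 2) (ler0n R 2) e1 e1 => e2.
      have := ler_pM (mulr_ge0 (ler0n R 2) (ler0n R 2)) (ler0n R 2) e2 e1; lra.
    have x1 : expR (ell th + cP - 1) <= expR (ell x + cP) by rewrite ler_expR; lra.
    apply: le_trans x1; rewrite -[ell th + cP - 1]/(ell th + cP + - 1) expRD.
    apply: (@le_trans _ _ (4^-1 * expR (cB - M / 2) * expR (- 1))); last first.
      by rewrite ler_wpM2r // expR_ge0.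
    apply: (@le_trans _ _ (2 * (expR (- 3) * expR (cB - M / 2 - 1)))).
      rewrite -expRD ler_wpM2l // ler_expR /gauss_exponent -/(q x).
      have : s < q x by exact: sx.
      rewrite /s; lra.
    rewrite expRD mulrA mulrA ler_wpM2r ?expR_ge0 // ler_wpM2r ?expR_ge0 //.
    rewrite expRN; have : (expR 3)^-1 <= 8^-1 :> R by rewrite lef_pV2 ?posrE ?expR_gt0.
    lra.
  have := PB _ mAW; rewrite ler_norml => /andP[_]; lra.
have BW : c <= delta + prob B W.
  apply: le_trans Bspread _; apply: le_trans (lerD BAW (lexx _)).
  apply: prob_cover => // x Ax; case: (pselect (W x)) => Wx; [by right|by left].
pose Tj (j : nat) := [set x | j%:R < dotp (x - th) (x - th)].
have mT j : measurable (Tj j) by exact: measurable_dotp_gt.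
(* A sample in [W] beyond squared radius [j] has lost at least 1, so every sample in [U] has initial
   squared speed above [j + 1]. Thus [P U] is at most the [B]-mass of [Tj j.+1] plus [delta], and
   comparing [P U] with [B U] costs another [delta]. *)
have step j : prob B (W `&` (Tj j `\` Tj j.+1)) <= 2 * delta.
  pose U := Tj j.+1 `|` (W `&` (Tj j `\` Tj j.+1)).
  have mV : measurable (W `&` (Tj j `\` Tj j.+1)).
    by apply: measurableI => //; exact: measurableD.
  have mU : measurable U by exact: measurableU.
  have mE' : measurable ((fun x => x + th) @^-1` Tj j.+1).
    rewrite (_ : _ @^-1` _ = [set x | j.+1%:R < dotp (x - 0) (x - 0)]).
      exact: measurable_dotp_gt.
    by apply/funext => x; rewrite /Tj /= addrK subr0.
  have sub v : U (Exp (grad_metric ell) th v) -> ((fun x => x + th) @^-1` Tj j.+1) v.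
    rewrite /U /Tj /= addrK; have := Exp_grad_metric_arc v Hell g0.
    set X := Exp _ _ _ => arc [Xj|[/= WX [Xj _]]].
      by apply: lt_le_trans Xj _; apply: le_trans arc; rewrite lerDl sqr_ge0.
    apply: lt_le_trans arc; rewrite -natr1; apply: ltr_leD => //.
    by rewrite -sqrrN opprB -[leLHS](expr1n _ 2) ler_sqr ?nnegrE // (le_trans ler01).
  have h1 := laplace_law_transfer mU mE' sub (Hlaw U mU).
  rewrite -BN // in h1.
  have h2 := PB U mU.
  have disj : Tj j.+1 `&` (W `&` (Tj j `\` Tj j.+1)) = set0.
    by apply/seteqP; split => x //= -[? [_ [_ ?]]].
  move: h2; rewrite ler_norml (prob_disjointU B (mT j.+1) mV disj) => /andP[h2 _].
  move: h1 h2; rewrite /U; lra.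
have BWT j : prob B (W `\` Tj j) <= 2 * delta * j%:R.
  elim: j => [|j IH].
    (* Outside [Tj 0] only [th] remains, and it is not in [W]. *)
    rewrite mulr0 (_ : W `\` Tj 0%N = set0) ?/prob ?measure0 //.
    apply/seteqP; split => x //= -[Wx]; rewrite /Tj /= => /negP; rewrite -leNgt.
    rewrite le_eqVlt ltNge dotp_ge0 orbF dotp_eq0 subr_eq0 => /eqP xth.
    by move: Wx; rewrite /W /= xth subrr ler10.
  rewrite -[j.+1%:R]natr1 mulrDr mulr1; apply: le_trans (lerD IH (step j)).
  apply: prob_cover; [exact: measurableD|exact: measurableD| |].
    by apply: measurableI => //; exact: measurableD.
  by move=> x [Wx nT]; case: (pselect (Tj j x)) => Tx; [right|left].
have BT : prob B (Tj J) <= c / 4.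
  have Bt := Btail (J%:R / K).
  rewrite (_ : 3 / 8 * (J%:R / K) = 3 / 8 / K * J%:R) in Bt; last by ring.
  apply: le_trans HJ; apply: le_trans Bt; apply: prob_le => //.
    exact: measurable_qform_gt.
  move=> x /= Jx; rewrite ltr_pdivrMr // mulrC.
  apply: lt_le_trans Jx _; apply: le_trans (dotp_le_qform _ pS) _.
  apply: ler_wpM2r; first by apply: posdef_qform_ge0; exact: posdef_invmx.
  apply: (@le_trans _ _ (n%:R * `|C|)); last by rewrite lerDl.
  rewrite -[n in leRHS]card_ord mulr_natl -sumr_const; apply: ler_sum => i _.
  by apply: le_trans (ler_norm _) _; apply: le_trans (HC i i) _; exact: ler_norm.
have : prob B W <= prob B (W `\` Tj J) + prob B (Tj J).
  apply: prob_cover => //; first exact: measurableD.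
  by move=> x Wx; case: (pselect (Tj J x)) => Tx; [right|left].
(* Altogether [c <= delta + 2 delta J + c / 4 = delta L + c / 4 <= c / 2], contradicting [0 < c]. *)
have := BWT J; move: d2; rewrite /L; lra.
Qed.

End laplace_gap.

(** * Radial tails of the Laplace law *)

Section laplace_tails.
Context {R : realType} {n : nat}.
Implicit Types (N B P : probability 'rV[R]_n R) (th v x : 'rV[R]_n).

Lemma measurable_enorm_gt th r : measurable [set x | r < enorm (x - th)].
Proof.
have [r0|r0] := ltP r 0.
  rewrite (_ : [set x | _] = setT) //; apply/seteqP; split => // x _ /=.
  by apply: lt_le_trans r0 _; exact: enorm_ge0.
rewrite (_ : [set x | _] = [set x | r ^+ 2 < dotp (x - th) (x - th)]).
  exact: measurable_dotp_gt.
apply/funext => x /=; rewrite -enorm_sqr ltr_pXn2r // nnegrE //.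
exact: enorm_ge0.
Qed.

Lemma Exp_grad_metric_enorm_le P ell th v : log_posterior P ell th ->
  enorm (Exp (grad_metric ell) th v - th) <= enorm v.
Proof.
move=> /log_posterior_grad[Hell g0]; rewrite enorm_le.
by apply: le_trans (Exp_grad_metric_arc v Hell g0); rewrite lerDl sqr_ge0.
Qed.

Lemma Exp_grad_metric_enorm_lt P ell th v : log_posterior P ell th ->
  posdef (laplace_cov ell th) -> v != 0 ->
  enorm (Exp (grad_metric ell) th v - th) < enorm v.
Proof.
move=> /log_posterior_grad[Hell g0] /posdef_of_invmx [_ pH] v0.
rewrite enorm_lt; apply: Exp_grad_metric_lt => //.
have := pH v v0; rewrite /qform mulmxN mulNmx mxE oppr_gt0.
by move=> /lt_eqF ->.
Qed.

(** [Exp] does not lengthen velocities, and [B] is [N] translated to [th]. *)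
Lemma laplace_tail_le P N B ell th r : log_posterior P ell th ->
  gaussian N 0 (laplace_cov ell th) -> gaussian B th (laplace_cov ell th) ->
  (laplace_law (grad_metric ell) th N [set x | (r < enorm (x - th))%R] <=
   B [set x | (r < enorm (x - th))%R])%E.
Proof.
move=> lP gN gB; have mr := measurable_enorm_gt th r.
rewrite (gauss_translate gN gB mr); apply: laplace_law_le.
  rewrite (_ : _ @^-1` _ = [set x | r < enorm (x - 0)]).
    exact: measurable_enorm_gt.
  by apply/funext => x; rewrite /= addrK subr0.
move=> v /= /lt_le_trans; apply; rewrite addrK.
exact: Exp_grad_metric_enorm_le lP.
Qed.

Lemma lt_energy (a b c e : R) : a + b ^+ 2 = c + e ^+ 2 -> e = 0 -> b != 0 -> a < c.
Proof.
move=> E e0 b0; have : 0 < b ^+ 2 by rewrite lt_def sqr_ge0 sqrf_eq0 b0.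
by move: E; rewrite e0 expr0n addr0 => <-; rewrite ltrDl.
Qed.

Lemma ge_tv_dist (mu nu : set 'rV[R]_n -> \bar R) A : measurable A ->
  (`|mu A - nu A| <= tv_dist mu nu)%E.
Proof. by move=> mA; apply: ereal_sup_ubound; exists A. Qed.

Lemma near_tv_dist (mu nu : nat -> set 'rV[R]_n -> \bar R) (e : R) : 0 < e ->
  tv_dist (mu k) (nu k) @[k --> \oo] --> 0%E ->
  \forall k \near \oo, forall A, measurable A -> (`|mu k A - nu k A| <= e%:E)%E.
Proof.
move=> e0 H.
have : nbhs (0%E : \bar R) [set y | (y < e%:E)%E].
  by apply: open_nbhs_nbhs; split; [exact: open_ereal_lt_ereal|rewrite /= lte_fin].
move=> /H Hn; near=> k => A mA.
apply: le_trans (ge_tv_dist _ _ mA) (ltW _); near: k; exact: Hn.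
Unshelve. all: by end_near. Qed.

End laplace_tails.

Theorem mainTheorem3 (R : realType) (D : nat) (hD : (0 < D)%N) :
  (forall (pi : probability 'rV[R]_D R) (ell : 'rV[R]_D -> R) (th : 'rV[R]_D),
    log_posterior pi ell th ->
    let G := grad_metric ell in
    [/\ grad ell th = 0 /\ G th = 1%:M,
        (* (i) *)
        forall (J : set R) (theta : R -> 'rV[R]_D),
          geodesic G J theta -> J 0 -> theta 0 = th ->
          let v := theta^`() in
          forall t, J t ->
            [/\ qform (G (theta t)) (v t) =
                  enorm (v t) ^+ 2 + dotp (v t) (grad ell (theta t)) ^+ 2,
                qform (G (theta t)) (v t) = qform (G (theta 0)) (v 0) &
                t != 0 ->
                  [\/ enorm (v t) < enorm (v 0), grad ell (theta t) = 0 |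
                      dotp (v t) (grad ell (theta t)) = 0]],
        (* (ii) *)
        [/\ forall v, Exp euclidean_metric th v = th + v /\
              enorm (Exp euclidean_metric th v - th) = enorm v,
            forall v, enorm (Exp G th v - th) <=
              enorm (Exp euclidean_metric th v - th) &
            forall N : probability 'rV[R]_D R,
              gaussian N 0 (laplace_cov ell th) ->
              {ae N, forall v, enorm (Exp G th v - th) <
                enorm (Exp euclidean_metric th v - th)}]
      & (* (iii), Gaussian targets *)
        forall (m : 'rV[R]_D) (S : 'M[R]_D) (N : probability 'rV[R]_D R),
          gaussian pi m S -> gaussian N 0 (laplace_cov ell th) ->
          [/\ ~ exact (laplace_law G th N) pi,
              forall r, (laplace_law G th N [set x | (r < enorm (x - th))%R] <=
                pi [set x | (r < enorm (x - th))%R])%E &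
              (\int[N]_v (enorm (Exp G th v - th) ^+ 2)%:E <
               \int[pi]_x (enorm (x - th) ^+ 2)%:E)%E]])
  /\
  (* (iii), infinite-data posteriors: the total variation limit is the conclusion
     of the Bernstein-von Mises theorem, in the original coordinates *)
  (forall (pi N B : nat -> probability 'rV[R]_D R)
      (ell : nat -> 'rV[R]_D -> R) (th : nat -> 'rV[R]_D) (C : R),
    (forall k, log_posterior (pi k) (ell k) (th k)) ->
    (forall k, gaussian (N k) 0 (laplace_cov (ell k) (th k))) ->
    (forall k, gaussian (B k) (th k) (laplace_cov (ell k) (th k))) ->
    (forall k i j, `|laplace_cov (ell k) (th k) i j| <= C) ->
    tv_dist (pi k) (B k) @[k --> \oo] --> 0%E ->
    let law k := laplace_law (grad_metric (ell k)) (th k) (N k) in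
    ~ (tv_dist (law k) (pi k) @[k --> \oo] --> 0%E) /\
    (forall eps : R, 0 < eps -> \forall k \near \oo, forall r,
      (law k [set x | (r < enorm (x - th k))%R] <=
       pi k [set x | (r < enorm (x - th k))%R] + eps%:E)%E)).
Proof.
(* Zero is the only velocity at which strictness can fail; it is a null set because [D] is
   positive. *)
have negl0 (ell : 'rV[R]_D -> R) th (N : probability 'rV[R]_D R) :
    gaussian N 0 (laplace_cov ell th) -> measurable [set (0 : 'rV[R]_D)] /\ N [set 0] = 0%E.
  move=> gN; have [c dN] := gaussian_density gN.
  have m0 : measurable [set (0 : 'rV[R]_D)].
    rewrite -(setCK [set 0]); apply: measurableC; apply: measurable_open_rV; rewrite openC.
    exact/accessible_closed_set1/hausdorff_accessible/norm_hausdorff.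
  split => //; apply: (density_null dN m0).
  by case: D hD {ell th N gN c dN m0} => // D' _; exact: leb_set1.
split.
- move=> pi ell th lP G; rewrite {}/G.
  have [Hell g0] := log_posterior_grad lP.
  split.
  + by split => //; rewrite /grad_metric g0 trmx0 mul0mx addr0.
  + move=> J theta geo J0 th0 t Jt.
    have E := geodesic_energy Hell geo Jt J0.
    have g00 : dotp (derive1 theta 0) (grad ell (theta 0)) = 0 by rewrite th0 g0 dotp0r.
    split; first by rewrite qform_grad_metric enorm_sqr.
      by rewrite !qform_grad_metric.
    move=> _; have [d0|d0] := eqVneq (dotp (derive1 theta t) (grad ell (theta t))) 0.
      by apply: Or33.
    apply: Or31; rewrite enorm_lt.
    exact: lt_energy E g00 d0.
  + have Ee v : Exp euclidean_metric th v - th = v by rewrite Exp_euclidean addrC addKr.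
    split.
    * by move=> v; rewrite Ee Exp_euclidean.
    * move=> v; apply: le_trans (Exp_grad_metric_enorm_le v lP) _.
      by rewrite Ee.
    * move=> N gN; have [m0 N0] := negl0 _ _ _ gN; have [pS _] := gN.
      exists [set 0]; split => // v /= nv; apply: contrapT => v0; apply: nv.
      apply: (@lt_le_trans _ _ (enorm v)); last by rewrite Ee.
      apply: (Exp_grad_metric_enorm_lt (v := v) lP pS); exact/eqP.
  + move=> m S N gpi gN.
    have [Em ES] := gaussian_log_posterior lP gpi; subst m; subst S.
    have [pS _] := gN.
    split.
    (* The Gaussian target is its own Laplace Gaussian, so [pi] serves as both [P] and [B] in the
       gap. *)
    * move=> ex; pose C := `|laplace_cov ell th|.
      have [delta d0 gap] := laplace_gap C hD.
      apply: (gap pi ell th N pi) => // [i j|A mA|A mA].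
      - rewrite /C [leRHS]/Num.Def.normr/= mx_normrE.
        exact: (le_bigmax _ (fun i : 'I_D * 'I_D => `|laplace_cov ell th i.1 i.2|) (i, j)).
      - by rewrite ex // subee ?fin_num_measure // abse0 lee_fin ltW.
      - by rewrite subee ?fin_num_measure // abse0 lee_fin ltW.
    * by move=> r; exact: (laplace_tail_le r lP gN gpi).
    * have cd := @continuous_dotp_sub R D.
      have mshift : measurable_fun setT (fun x : 'rV[R]_D => x + th).
        rewrite (_ : (fun x => x + th) = (fun x => 1 *: x + th)); last by apply/funext => x; rewrite scale1r.
        exact: measurable_affine_rV.
      have [c dN] := gaussian_density gN.
      have Epi : (\int[pi]_x (enorm (x - th) ^+ 2)%:E = \int[N]_v (enorm v ^+ 2)%:E)%E.
        transitivity (\int[image_measure N mshift]_x (enorm (x - th) ^+ 2)%:E)%E.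
          by apply: eq_measure_integral => A mA _; exact: gauss_translate gN gpi mA.
        rewrite (ge0_integral_image_measure N mshift measurableT).
        - by rewrite preimage_setT; apply: eq_integral => v _; rewrite addrK.
        - under eq_fun do rewrite enorm_sqr; exact: measurable_EFin_continuous.
        - by move=> x; rewrite lee_fin sqr_ge0.
      rewrite Epi; have [m0 N0] := negl0 _ _ _ gN.
      apply: (@lt_integral_nonmeasurable _ _ _ N
        (fun v => enorm (Exp (grad_metric ell) th v - th) ^+ 2)
        (fun v => enorm v ^+ 2) [set 0]) => //.
      - under eq_fun do rewrite enorm_sqr.
        have := continuous_measurable_rV (cd 0).
        by under eq_fun do rewrite subr0.
      - move=> v; rewrite sqr_ge0 /= ler_pXn2r ?nnegrE ?enorm_ge0 //.
        exact: (Exp_grad_metric_enorm_le v lP).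
      - move=> v v0; rewrite ltr_pXn2r ?nnegrE ?enorm_ge0 //.
        apply: (Exp_grad_metric_enorm_lt (v := v) lP pS); exact/eqP.
      - apply: le_lt_trans (gauss_second_moment pS dN); rewrite le_eqVlt.
        apply/orP; left; apply/eqP; apply: eq_integral => v _.
        by rewrite enorm_sqr subr0.
- move=> pi N B ell th C lP gN gB HC tvPB law; split.
    (* Were both total variation limits 0, some index [k] would meet both bounds of the gap. *)
    move=> tvL; have [delta d0 gap] := laplace_gap C hD.
    have HL := near_tv_dist d0 tvL; have HP := near_tv_dist d0 tvPB.
    have [k [HLk HPk]] := filter_ex (filterI HL HP).
    exact: gap (lP k) (gN k) (gB k) (HC k) HLk HPk.
  move=> eps eps0; have := near_tv_dist eps0 tvPB; apply: filterS => k Hk r.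
  have mr := measurable_enorm_gt (th k) r.
  apply: le_trans (laplace_tail_le r (lP k) (gN k) (gB k)) _.
  have := Hk _ mr; rewrite (probE (pi k) mr) (probE (B k) mr) lee_fin -EFinD lee_fin.
  rewrite ler_norml => /andP[+ _]; lra.
Qed.
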